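(* There is an absolute constant $C>0$ such that the following holds. Let $d\in\mathbb{N}$, let $\Gamma\subset\mathbb{Z}^d$ be finite with $D=|\Gamma|$, let $M\in\mathbb{N}$, and let $f\in\Pi_\Gamma(M)$ with Fourier coefficients $c\in\mathbb{C}^\Gamma$. Let $N\in\mathbb{N}$ and $\tau,\epsilon\in(0,1)$ be such that $$N\geq C\,M\,\tau^{-2}\log(D/\epsilon).$$ Further, let $\sigma>0$ be such that $$\sigma\le\frac{1-\tau}{4}\sqrt{\frac{N}{M}}\,\|c\|_2 .$$ Choose the random sampling set $X=(x_1,\dots,x_N)$ according to probability model (1) or probability model (2). Assume that noisy samples $y=(f(x_\ell))_{\ell=1}^N+\eta=\mathcal{F}_Xc+\eta$ with $\|\eta\|_2\le\sigma$ are given. Then with probability exceeding $1-\epsilon$, Orthogonal Matching Pursuit (OMP) applied to $y$ selects an element of the true support $\operatorname{supp}c$ in the first step. Moreover, with probability exceeding $1-\epsilon$ the following implication holds: if after $M$ steps OMP recovers the complete support of $c$ (that is, $T_M=\operatorname{supp}c$), then the reconstructed coefficients $\tilde c$ satisfy $$\|c-\tilde c\|_2\le\sqrt{\frac{2}{N}}\,\sigma .$$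
   Context: For a finite set $\Gamma\subset\mathbb{Z}^d$, $\Pi_\Gamma(M)$ is the set of trigonometric polynomials $f(x)=\sum_{k\in\Gamma}c_ke^{ik\cdot x}$, $x\in[0,2\pi]^d$, whose coefficient vector $c=(c_k)_{k\in\Gamma}\in\mathbb{C}^\Gamma$ is supported on some $T\subset\Gamma$ with $|T|\le M$; $\operatorname{supp}c=\{k\in\Gamma:c_k\neq0\}$. For sampling points $X=(x_1,\dots,x_N)$ in $[0,2\pi]^d$, $\mathcal{F}_X$ is the $N\times|\Gamma|$ matrix with entries $(\mathcal{F}_X)_{j,k}=e^{ik\cdot x_j}$, so that $f(x_j)=(\mathcal{F}_Xc)_j$. Its $k$-th column is denoted $\phi_k=(e^{ik\cdot x_\ell})_{\ell=1}^N$, and $\mathcal{F}_{TX}$ denotes its restriction to the columns indexed by $T\subset\Gamma$. Probability models. Model (1) (continuous): $x_1,\dots,x_N$ are independent random variables, each uniformly distributed on the cube $[0,2\pi]^d$. Model (2) (discrete): $x_1,\dots,x_N$ are independent random variables, each uniformly distributed on the grid $\{0,\frac{2\pi}{q},\dots,2\pi\frac{q-1}{q}\}^d$, where $q\in\mathbb{N}$ is such that $\Gamma\subseteq\{0,1,\dots,q-1\}^d$. OMP with input $y\in\mathbb{C}^N$: set $r_0=y$, $T_0=\emptyset$. In step $s=1,2,\dots$: choose $k_s\in\arg\max_{k\in\Gamma}|\langle r_{s-1},\phi_k\rangle|$ (the element selected in step $s$); set $T_s=T_{s-1}\cup\{k_s\}$; let $d_s$ be a minimizer of $\|\mathcal{F}_{T_sX}d-y\|_2$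 over $d\in\mathbb{C}^{T_s}$; set $r_s=y-\mathcal{F}_{T_sX}d_s$. When stopped after step $s$, the reconstructed coefficient vector $\tilde c\in\mathbb{C}^\Gamma$ is equal to $d_s$ on $T_s$ and zero outside $T_s$. *)

(* Defs.v *)
From HB Require Import structures.
From mathcomp Require Export all_boot all_order all_algebra finmap complex.
From mathcomp Require Export all_classical all_reals all_analysis.

Set Implicit Arguments.
Unset Strict Implicit.
Unset Printing Implicit Defensive.

Import Order.TTheory GRing.Theory Num.Theory.
Import numFieldNormedType.Exports.

Local Open Scope classical_set_scope.
Local Open Scope complex_scope.
Local Open Scope ring_scope.

Definition l2norm (R : realType) (I : finType) (v : I -> R[i]) : R :=
  Num.sqrt (\sum_i Normc.normc (v i) ^+ 2).

Definition dotc (R : realType) (I : finType) (u v : I -> R[i]) : R[i] :=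
  \sum_i u i * (v i)^*.

Definition supp (R : realType) (I : finType) (c : I -> R[i]) : {set I} :=
  [set k | c k != 0]%SET.

Section Fourier.
Variables (R : realType) (d : nat).

(* e^{i k.x} *)
Definition character_at (k : d.-tuple int) (x : d.-tuple R) : R[i] :=
  let t := \sum_(i < d) (tnth k i)%:~R * tnth x i in cos t +i* sin t.

Variable Gamma : {fset d.-tuple int}.

Definition trig_poly (c : Gamma -> R[i]) (x : d.-tuple R) : R[i] :=
  \sum_(k : Gamma) c k * character_at (val k) x.

(* f lies in Pi_Gamma(M), c being its vector of Fourier coefficients. *)
Definition in_Pi (M : nat) (c : Gamma -> R[i]) (f : d.-tuple R -> R[i]) : Prop :=
  (exists T : {set Gamma},
     (#|T| <= M)%N /\ (forall k, k \notin T -> c k = 0)) /\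
  f = trig_poly c.

Variables (N : nat) (x : 'I_N -> d.-tuple R).

(* The column phi_k of the matrix F_X. *)
Definition phi (k : Gamma) : 'I_N -> R[i] :=
  fun l => character_at (val k) (x l).

(* F_{TX} u.  A vector of C^T is represented by u : Gamma -> C, whose values
   outside T are never used. *)
Definition F_mul (T : {set Gamma}) (u : Gamma -> R[i]) : 'I_N -> R[i] :=
  fun l => \sum_(k in T) phi k l * u k.

(* S steps of OMP with input y, as a relation since neither the maximizer k_s
   nor (if F_{TX} is not injective) the minimizer d_s need be unique.  Steps are
   numbered from 1; sel 0 and coef 0 are irrelevant. *)
Record omp_run (y : 'I_N -> R[i]) (S : nat) := OmpRun {
  sel : nat -> Gamma ;
  act : nat -> {set Gamma} ;
  coef : nat -> Gamma -> R[i] ;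
  res : nat -> 'I_N -> R[i] ;
  omp_act0 : act 0%N = finset.set0 ;
  omp_res0 : res 0%N = y ;
  omp_sel : forall s, (s < S)%N -> forall k,
    Normc.normc (dotc (res s) (phi k))
    <= Normc.normc (dotc (res s) (phi (sel s.+1))) ;
  omp_act : forall s, (s < S)%N -> act s.+1 = (act s :|: [set sel s.+1])%SET ;
  omp_coef : forall s, (s < S)%N -> forall u : Gamma -> R[i],
    l2norm (fun l => F_mul (act s.+1) (coef s.+1) l - y l)
    <= l2norm (fun l => F_mul (act s.+1) u l - y l) ;
  omp_res : forall s, (s < S)%N ->
    res s.+1 = fun l => y l - F_mul (act s.+1) (coef s.+1) l
}.

Definition omp_output (y : 'I_N -> R[i]) (S : nat) (r : omp_run y S) :
    Gamma -> R[i] :=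
  fun k => if k \in act r S then coef r S k else 0.

End Fourier.

Section Sampling.
Variable R : realType.

(* d-dimensional Lebesgue measure, as the iterated product measure: the second
   case unfolds product_measure1 along R^n.+1 = R x R^n. *)
Fixpoint lebesgue_tuple (n : nat) : set (n.-tuple R) -> \bar R :=
  match n return set (n.-tuple R) -> \bar R with
  | 0%N => fun A => (\1_A [tuple])%:E
  | m.+1 => fun A =>
      (\int[lebesgue_measure]_(t in [set: R])
         lebesgue_tuple [set v : m.-tuple R | A [tuple of t :: v]])%E
  end.

Definition cube (d : nat) : set (d.-tuple R) :=
  [set v | forall i, 0 <= tnth v i <= 2 * pi].

Definition grid_point (d q : nat) (a : d.-tuple 'I_q) : d.-tuple R :=
  [tuple 2 * pi * (tnth a i)%:R / q%:R | i < d].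

Context (disp : measure_display) (Omega : measurableType disp).
Variable P : probability Omega R.

Definition mutually_independent (disp' : measure_display)
    (E : measurableType disp') (N : nat) (X : 'I_N -> {RV P >-> E}) : Prop :=
  forall (J : {set 'I_N}) (A : 'I_N -> set E),
    (forall j, measurable (A j)) ->
    P (\bigcap_(j in [set` J]) (X j @^-1` A j))
    = (\prod_(j in J) P (X j @^-1` A j))%E.

Variables (d N : nat) (X : 'I_N -> {RV P >-> d.-tuple (measurableTypeR R)}).

Definition uniform_on_cube : Prop :=
  forall j A, measurable A ->
    distribution P (X j) A
    = ((((2 * pi) ^+ d)^-1)%:E * lebesgue_tuple (A `&` @cube d))%E.

Definition uniform_on_grid (q : nat) : Prop :=
  forall j A, measurable A ->
    distribution P (X j) A
    = ((\sum_(a : d.-tuple 'I_q) \1_A (grid_point a)) / (q%:R ^+ d))%:E.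

Definition model1 : Prop := mutually_independent X /\ uniform_on_cube.

Definition model2 (Gamma : {fset d.-tuple int}) : Prop :=
  exists q : nat,
    [/\ (0 < q)%N,
        forall k : Gamma, forall i : 'I_d, 0 <= tnth (val k) i < q%:Z,
        mutually_independent X & uniform_on_grid q].

(* "Q holds with probability exceeding p".  Q need not be assumed measurable:
   it is only required to hold on a measurable event of probability > p. *)
Definition prob_exceeds (p : R) (Q : Omega -> Prop) : Prop :=
  exists E : set Omega,
    [/\ measurable E, forall w, E w -> Q w & (p%:E < P E)%E].

End Sampling.

(* Main.v *)
From HB Require Import structures.
Require Import Defs.
From mathcomp Require Import measurable_realfun spectral sesquilinear ring lra.

(** Write e_k (x) for the character exp (i k.x), D for the number of
    frequencies, |c| for the l2 norm of c and T for its support.  Only two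
    consequences of the sampling models matter: the sample points are
    independent, and under the law of each of them the mean of e_k conj(e_l)
    vanishes when k <> l ([model_cancelling]).

    _First step_.  The correlation of the noiseless samples with the column of
    k is N c_k plus the sum over the samples of the trigonometric polynomial
    Z_k = sum over j <> k of c_j e_j conj(e_k), which is centred, has variance
    at most |c|^2 and is bounded by the l1 norm of c, that is by sqrt M |c|.
    A Bernstein estimate and a union bound over k and over four directions of
    the complex plane make all these sums at most N |c| / (4 sqrt M)
    ([off_deviation]).  In the unit N |c| / sqrt M, the noise contributes at
    most (1 - tau) / 4 to a correlation, while the largest |c_k| is at least
    |c| / sqrt M.  So a correlation inside T is at least
    3 / 4 - (1 - tau) / 4, and outside T all of them are at most
    1 / 4 + (1 - tau) / 4, which is smaller ([first_step_correct]).

    _Reconstruction_.  When the active set is T, the least squares error is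
    controlled by the smallest singular value of the columns indexed by T: it is
    enough that |F u|^2 >= (N / 2) |u|^2 for every u supported on T
    ([least_squares_error]).  The Gram matrix of these columns is a sum of N
    independent rank one matrices v^* v with mean the identity and
    |v|^2 = #|T| <= M, so this is a matrix Chernoff bound, which must hold with
    only a logarithmic loss in the dimension ([gram_lower_bound]).  It is proved
    with the potential tr (B^-p): start from B = 2 N and for each sample replace
    B by B - 3/4 + v^* v.  Subtracting 3/4 raises the potential by at most
    (3/4) p tr (B^-(p+1)) ([mxtrace_resolvent_shift]); adding v^* v lowers it by
    at least (3/4) p v B^-(p+1) v^* ([resolvent_rank_one_update]), whose mean is
    the same quantity.  Hence the mean of the potential never exceeds its
    initial value #|T| (2 N)^-p.  If the Gram matrix fails to be at least N / 2,
    the final B has an eigenvalue below 2 N - (3/4) N + N / 2 = (7/4) N and the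
    potential is at least ((7/4) N)^-p, so by Markov's inequality this happens
    with probability at most #|T| (7/8)^p, less than eps once p is of the order
    of log (D / eps).  The update step needs p M to be at most a fraction of N,
    and this is the hypothesis on N.

    The noncommutative ingredient is the Lieb-Thirring inequality
    tr ((G H)^p) <= tr (G^p H^p) for Hermitian G and H
    ([lieb_thirring_pow2]).  Taking p to be a power of two makes it elementary:
    it then follows from the Cauchy-Schwarz inequality by induction.

    Both expectations are estimated by integrating out one sample at a time
    ([potential_le]) against the joint law, which independence identifies with
    an iterated product ([joint_law]).  If D = 1 then log (D / eps) can be
    arbitrarily small, and both claims hold for every choice of the samples. *)

Set Implicit Arguments.
Unset Strict Implicit.
Unset Printing Implicit Defensive.

Import Order.TTheory GRing.Theory Num.Theory.
Import numFieldNormedType.Exports.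

Local Open Scope ring_scope.
Local Open Scope sesquilinear_scope.

(** * Trace inequalities for powers of two *)

Section TraceInequalities.
Variables (C : numClosedFieldType) (n : nat).
Implicit Types A B G H Z : 'M[C]_n.+1.

Lemma trCmx_mul m p q (A : 'M[C]_(m, p)) (B : 'M[C]_(p, q)) :
  (A *m B)^t* = B^t* *m A^t*.
Proof. by rewrite trmx_mul map_mxM. Qed.

Lemma trCmxM A B : (A * B)^t* = B^t* * A^t*.
Proof. exact: trCmx_mul. Qed.

Lemma trCmx_exp A k : (A ^+ k)^t* = (A^t*) ^+ k.
Proof.
elim: k => [|k IH]; first by rewrite !expr0 trmx1 map_mx1.
by rewrite exprSr trCmxM IH exprS.
Qed.

Lemma mxtrace_expMC A B k : \tr ((A * B) ^+ k) = \tr ((B * A) ^+ k).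
Proof.
case: k => [|k]; first by rewrite !expr0.
have -> : (A * B) ^+ k.+1 = A * ((B * A) ^+ k * B).
  elim: k => [|k IH]; first by rewrite expr1 expr0 mul1r.
  by rewrite exprS {}IH [(B * A) ^+ k.+1]exprS !mulrA.
by rewrite mxtrace_mulC -[_ *m _]/(_ * _) -mulrA -exprSr.
Qed.

Lemma mxtrace_gram A : \tr (A^t* * A) = \sum_i \sum_j `|A i j| ^+ 2.
Proof.
rewrite exchange_big /mxtrace; apply: eq_bigr => i _; rewrite mxE.
by apply: eq_bigr => j _; rewrite !mxE mulrC normCK.
Qed.

(** Cauchy-Schwarz for the Hilbert-Schmidt product, with the geometric mean of
    the two norms replaced by their arithmetic mean, which avoids square roots
    and is enough below. *)
Lemma norm_mxtraceM_le A B :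
  `|\tr (A * B)| <= (\tr (A^t* * A) + \tr (B^t* * B)) / 2.
Proof.
rewrite !mxtrace_gram [X in _ + X]exchange_big /= -big_split /=.
rewrite [\tr _]/mxtrace mulr_suml; apply: le_trans (ler_norm_sum _ _ _) _.
apply: ler_sum => i _; rewrite mxE -big_split /= mulr_suml.
apply: le_trans (ler_norm_sum _ _ _) _; apply: ler_sum => j _.
rewrite normrM ler_pdivlMr ?ltr0n //.
have : 0 <= (`|A i j| - `|B j i|) ^+ 2.
  by rewrite real_exprn_even_ge0 // realB // normr_real.
by rewrite sqrrB mulr_natr -mulr_natr !mulr_natr addrAC subr_ge0.
Qed.

(** The two halves are proved by a common induction. The first half at [k.+1] is
    the first half for [Z ^+ 2] at [k]: after a cyclic permutation the
    right-hand side is the trace of a power of a product of the Hermitian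
    matrices [Z^t* * Z] and [Z * Z^t*], to which the second half applies, and
    these two matrices have the same traces of powers. The second half at [k.+1]
    is the first half for [G * H] followed by the second half for [G * G] and [H
    * H]. *)
Lemma schatten_pow2 k :
  (forall Z, `|\tr (Z ^+ (2 ^ k.+1))| <= \tr ((Z^t* * Z) ^+ (2 ^ k))) /\
  (forall G H, G^t* = G -> H^t* = H ->
    `|\tr ((G * H) ^+ (2 ^ k))| <=
      (\tr (G ^+ (2 ^ k.+1)) + \tr (H ^+ (2 ^ k.+1))) / 2).
Proof.
have mean2 (x : C) : (x + x) / 2 = x.
  by rewrite -mulr2n -[x *+ 2]mulr_natr mulfK // pnatr_eq0.
elim: k => [|k [IHP IHQ]]; split.
- move=> Z; rewrite expn1 expn0 expr1 expr2.
  by apply: le_trans (norm_mxtraceM_le _ _) _; rewrite mean2.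
- move=> G H hG hH; rewrite expn0 expr1 expn1 !expr2.
  by apply: le_trans (norm_mxtraceM_le _ _) _; rewrite hG hH.
- move=> Z; rewrite expnS exprM.
  have := IHP (Z ^+ 2).
  rewrite expr2 trCmxM -mulrA mxtrace_expMC -!mulrA mulrA => h0.
  have hG : (Z^t* * Z)^t* = Z^t* * Z by rewrite trCmxM trmxCK.
  have hH : (Z * Z^t*)^t* = Z * Z^t* by rewrite trCmxM trmxCK.
  apply: (le_trans h0); apply: le_trans (real_ler_norm _) _.
    by rewrite ger0_real // (le_trans _ h0).
  have := IHQ _ _ hG hH.
  by rewrite (mxtrace_expMC Z) mean2.
- move=> G H hG hH.
  have := IHP (G * H).
  rewrite trCmxM hG hH -(mulrA H) (mxtrace_expMC H) -!mulrA mulrA => h0.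
  apply: (le_trans h0); apply: le_trans (real_ler_norm _) _.
    by rewrite ger0_real // (le_trans _ h0).
  have hG2 : (G * G)^t* = G * G by rewrite trCmxM hG.
  have hH2 : (H * H)^t* = H * H by rewrite trCmxM hH.
  have := IHQ _ _ hG2 hH2.
  by rewrite ![(2 ^ k.+2)%N]expnS !exprM !expr2.
Qed.

Lemma mxtrace_trC A : \tr (A^t*) = (\tr A)^*.
Proof. by rewrite rmorph_sum; apply: eq_bigr => i _; rewrite !mxE. Qed.

(** Each doubling of the exponent replaces the Hermitian factors [G] and [H] by
    [G * G] and [H * H], through the first half of [schatten_pow2]. *)
Lemma lieb_thirring_pow2 k G H : G^t* = G -> H^t* = H ->
  \tr ((G * H) ^+ (2 ^ k)) <= \tr (G ^+ (2 ^ k) * H ^+ (2 ^ k)).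
Proof.
elim: k G H => [|k IH] G H hG hH; first by rewrite expn0 !expr1.
have trR : \tr ((G * H) ^+ (2 ^ k.+1)) \is Num.real.
  by apply/CrealP; rewrite -mxtrace_trC trCmx_exp trCmxM hG hH mxtrace_expMC.
have [/(_ (G * H)) + _] := schatten_pow2 k.
rewrite trCmxM hG hH -(mulrA H) (mxtrace_expMC H) -!mulrA mulrA => h0.
apply: le_trans (real_ler_norm trR) _; apply: le_trans h0 _.
have hG2 : (G * G)^t* = G * G by rewrite trCmxM hG.
have hH2 : (H * H)^t* = H * H by rewrite trCmxM hH.
by rewrite ![(2 ^ k.+1)%N]expnS !exprM !expr2; exact: IH.
Qed.
End TraceInequalities.

(** * Spectral calculus and the resolvent potential *)

Section Resolvent.
Variables (C : numClosedFieldType) (n : nat).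
Implicit Types (A B G H : 'M[C]_n.+1) (u v : 'rV[C]_n.+1).

Definition qform B u : C := (u *m B *m u^t*) 0 0.
Definition sqnorm u : C := (u *m u^t*) 0 0.

Lemma sqnormE u : sqnorm u = \sum_i `|u 0 i| ^+ 2.
Proof. by rewrite /sqnorm mxE; apply: eq_bigr => i _; rewrite !mxE normCK. Qed.

Section Calculus.
Variables (P : 'M[C]_n.+1) (d : 'rV[C]_n.+1).
Hypothesis P_unitary : P \is unitarymx.

(** Functional calculus: [f] applied to the Hermitian matrix that has the
    orthonormal eigenvectors [row i P] and the eigenvalues [d 0 i]. *)
Definition spectral_fun (f : C -> C) : 'M[C]_n.+1 :=
  P^t* *m diag_mx (map_mx f d) *m P.

Lemma spectral_funM f g :
  spectral_fun f * spectral_fun g = spectral_fun (fun x => f x * g x).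
Proof.
rewrite /spectral_fun -[_ * _]/(_ *m _) !mulmxA mulmxtVK // -[P^t* *m _ *m _]mulmxA.
rewrite mulmx_diag; congr (_ *m diag_mx _ *m _).
by apply/rowP => i; rewrite !mxE.
Qed.

Lemma eq_spectral_fun f g : (forall i, f (d 0 i) = g (d 0 i)) ->
  spectral_fun f = spectral_fun g.
Proof.
move=> fg; rewrite /spectral_fun; congr (_ *m diag_mx _ *m _).
by apply/rowP => i; rewrite !mxE.
Qed.

Lemma spectral_fun_cst (a : C) : spectral_fun (fun=> a) = a%:M.
Proof.
rewrite /spectral_fun; have -> : map_mx (fun=> a) d = const_mx a.
  by apply/rowP => i; rewrite !mxE.
rewrite diag_const_mx -scalemx1 -scalemxAr -scalemxAl mulmx1.
by rewrite -invmx_unitary // mulVmx ?unitarymx_unit // scalemx1.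
Qed.

Lemma spectral_funD f g :
  spectral_fun f + spectral_fun g = spectral_fun (fun x => f x + g x).
Proof.
rewrite /spectral_fun -mulmxDl -mulmxDr -raddfD; congr (_ *m diag_mx _ *m _).
by apply/rowP => i; rewrite !mxE.
Qed.

Lemma spectral_funX f k :
  spectral_fun f ^+ k = spectral_fun (fun x => f x ^+ k).
Proof.
elim: k => [|k IH].
  by rewrite expr0 -[1]/(1%:M) -(spectral_fun_cst 1); exact: eq_spectral_fun.
by rewrite exprS IH spectral_funM; apply: eq_spectral_fun => i; rewrite exprS.
Qed.

Lemma mxtrace_spectral_fun f : \tr (spectral_fun f) = \sum_i f (d 0 i).
Proof.
rewrite /spectral_fun mxtrace_mulC !mulmxA (unitarymxP P_unitary) mul1mx.
by rewrite mxtrace_diag; apply: eq_bigr => i _; rewrite mxE.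
Qed.

Lemma trC_spectral_fun f : (forall i, (f (d 0 i))^* = f (d 0 i)) ->
  (spectral_fun f)^t* = spectral_fun f.
Proof.
move=> fR; rewrite /spectral_fun !trCmx_mul trmxCK !mulmxA.
congr (_ *m _ *m _); rewrite tr_diag_mx map_diag_mx; congr diag_mx.
by apply/rowP => i; rewrite !mxE; exact: fR.
Qed.

Lemma invmx_spectral_fun f : (forall i, f (d 0 i) != 0) ->
  invmx (spectral_fun f) = spectral_fun (fun x => (f x)^-1).
Proof.
move=> f0; have e : spectral_fun f * spectral_fun (fun x => (f x)^-1) = 1.
  rewrite spectral_funM -[1]/(1%:M) -(spectral_fun_cst 1).
  by apply: eq_spectral_fun => i; rewrite mulfV.
have [fU _] := mulmx1_unit e.
by rewrite -[LHS]mulmx1 -[1%:M]/1 -e -[_ * _]/(_ *m _) mulKmx.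
Qed.

Lemma qform_spectral_fun f u :
  qform (spectral_fun f) u = \sum_i f (d 0 i) * `|(u *m P^t*) 0 i| ^+ 2.
Proof.
rewrite /qform /spectral_fun !mulmxA -mulmxA.
have -> : P *m u^t* = (u *m P^t*)^t* by rewrite trCmx_mul trmxCK.
move: (u *m P^t*) => w; rewrite mxE; apply: eq_bigr => i _.
by rewrite mul_mx_diag !mxE normCK mulrCA mulrA.
Qed.

Lemma sqnorm_spectral u : sqnorm u = \sum_i `|(u *m P^t*) 0 i| ^+ 2.
Proof.
have -> : sqnorm u = qform (spectral_fun (fun=> 1)) u.
  by rewrite spectral_fun_cst /qform mulmx1.
by rewrite qform_spectral_fun; apply: eq_bigr => i _; rewrite mul1r.
Qed.

Lemma qform_eigenrow f i : qform (spectral_fun f) (row i P) = f (d 0 i).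
Proof.
rewrite qform_spectral_fun -row_mul (unitarymxP P_unitary) (bigD1 i) //=.
rewrite !mxE eqxx normr1 expr1n mulr1 big1 ?addr0 // => j /negbTE ji.
by rewrite !mxE eq_sym ji normr0 expr0n mulr0.
Qed.

Lemma sqnorm_eigenrow i : sqnorm (row i P) = 1.
Proof.
have := qform_eigenrow (fun=> 1) i.
by rewrite spectral_fun_cst /qform mulmx1.
Qed.

End Calculus.

Definition selfadjoint B := B^t* = B.

Lemma selfadjoint_spectral B : selfadjoint B -> exists (P : 'M[C]_n.+1) (d : 'rV[C]_n.+1),
  [/\ P \is unitarymx, forall i : 'I_n.+1, d 0 i \is Num.real
    & B = spectral_fun P d id].
Proof.
move=> hB.
have B_herm : B \is hermsymmx.
  by apply/is_hermitianmxP; rewrite expr0 scale1r; exact: esym hB.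
exists (spectralmx B), (spectral_diag B); split.
- exact: spectral_unitarymx.
- by move=> i; have /mxOverP := hermitian_spectral_diag_real B_herm; apply.
- have /orthomx_spectralP {1}-> := hermitian_normalmx B_herm.
  rewrite invmx_unitary ?spectral_unitarymx // /spectral_fun.
  by congr (_ *m diag_mx _ *m _); apply/rowP => i; rewrite !mxE.
Qed.

(** The Loewner order [B >= a 1], as a bound on the quadratic form. *)
Definition mx_ge B (a : C) := forall u, a * sqnorm u <= qform B u.

Lemma mx_geP P d a : P \is unitarymx ->
  mx_ge (spectral_fun P d id) a <-> forall i, a <= d 0 i.
Proof.
move=> uP; split=> [ge_a i|ge_a u].
  by have := ge_a (row i P); rewrite sqnorm_eigenrow // qform_eigenrow // mulr1.
rewrite qform_spectral_fun // (sqnorm_spectral d uP) mulr_sumr.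
by apply: ler_sum => i _; rewrite ler_wpM2r // exprn_ge0.
Qed.

Lemma bernoulli_inv (x : C) p : 0 <= x -> 1 - p%:R * x <= ((1 + x)^-1) ^+ p.
Proof.
move=> x0; have x1 : 0 < 1 + x by rewrite ltr_pwDl.
elim: p => [|p IH]; first by rewrite mul0r subr0 expr0.
rewrite exprSr ler_pdivlMr //; apply: le_trans IH.
rewrite -subr_ge0 -natr1.
have -> : 1 - p%:R * x - (1 - (p%:R + 1) * x) * (1 + x) = (p%:R + 1) * x ^+ 2.
  by ring.
by rewrite mulr_ge0 ?exprn_ge0 // natr1 ler0n.
Qed.

(** On an eigenvalue [x] the inequality reads [x^-p (1 - p kappa / x) <= (x +
    kappa)^-p], which is Bernoulli's inequality. *)
Lemma mxtrace_resolvent_shift B (L kappa : C) p :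
  selfadjoint B -> mx_ge B L -> 0 < L -> 0 <= kappa ->
  \tr (invmx B ^+ p) - kappa * p%:R * \tr (invmx B ^+ p.+1)
    <= \tr (invmx (B + kappa%:M) ^+ p).
Proof.
move=> hB + L0 k0; have [P [d [uP dR ->]]] := selfadjoint_spectral hB.
move=> /(mx_geP _ _ uP) Ld; have d0 i : 0 < d 0 i by apply: lt_le_trans (Ld i).
rewrite -(spectral_fun_cst d uP) spectral_funD !invmx_spectral_fun //; last 2 first.
- by move=> i; rewrite gt_eqF // ltr_wpDr.
- by move=> i; rewrite gt_eqF.
rewrite !spectral_funX // !mxtrace_spectral_fun // mulr_sumr -sumrB.
apply: ler_sum => i _; set x := d 0 i.
have x0 : 0 < x by apply: d0.
have -> : (x + kappa)^-1 = x^-1 * (1 + kappa / x)^-1.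
  by rewrite -invfM mulrDr mulr1 mulrCA mulfV ?gt_eqF // mulr1.
rewrite exprMn exprSr mulrCA -{1}[x^-1 ^+ p]mulr1 -mulrBr.
apply: ler_wpM2l; first by rewrite exprn_ge0 // invr_ge0 ltW.
rewrite mulrAC [_ * p%:R]mulrC; apply: bernoulli_inv.
by rewrite divr_ge0 // ltW.
Qed.

Definition outer v : 'M[C]_n.+1 := v^t* *m v.

Lemma mul_row_trC u v : u *m v^t* = ((u *m v^t*) 0 0)%:M.
Proof. exact: mx11_scalar. Qed.

Lemma outerM v : outer v * outer v = sqnorm v *: outer v.
Proof.
rewrite /outer -[_ * _]/(_ *m _) !mulmxA -[_ *m v *m _]mulmxA.
by rewrite mul_row_trC -/(sqnorm v) scalar_mxC mul_scalar_mx scalemxAl.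
Qed.

Lemma trC_outer v : (outer v)^t* = outer v.
Proof. by rewrite trCmx_mul trmxCK. Qed.

Lemma mxtrace_outerM v B : \tr (outer v * B) = qform B v.
Proof.
rewrite /outer -[_ * _]/(_ *m _) -mulmxA mxtrace_mulC.
by rewrite -[RHS]trace_mx11.
Qed.

Lemma sqnorm_ge0 v : 0 <= sqnorm v.
Proof. by rewrite sqnormE sumr_ge0 // => i _; rewrite exprn_ge0. Qed.

(** The matrix [1 - a *: outer w] is the inverse of [1 + outer w]; its powers
    keep this shape because [outer w] is idempotent up to the scalar [sqnorm w].
    *)
Lemma sub_outerX w p (a := (1 + sqnorm w)^-1) :
  (1 - a *: outer w) ^+ p = 1 - (\sum_(i < p) a ^+ i.+1) *: outer w.
Proof.
have w1 : 1 + sqnorm w != 0 by rewrite gt_eqF // ltr_pwDl // sqnorm_ge0.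
have aw : 1 - a * sqnorm w = a by rewrite /a; field.
have gw q : 1 - (\sum_(i < q) a ^+ i.+1) * sqnorm w = a ^+ q.
  elim: q => [|q IH]; first by rewrite big_ord0 mul0r subr0.
  rewrite big_ord_recr /= mulrDl opprD addrA IH.
  by rewrite exprSr -mulrA -{1}[a ^+ q]mulr1 -mulrBr aw.
elim: p => [|p IH]; first by rewrite expr0 big_ord0 scale0r subr0.
rewrite exprSr {}IH mulrBr mulr1 mulrBl mul1r -scalerAl -scalerAr outerM !scalerA.
rewrite big_ord_recr /= -addrA -opprD; congr (_ - _).
rewrite -scalerBl -scalerDl; congr (_ *: _).
rewrite exprSr -gw; ring.
Qed.

Lemma mxtraceB A B : \tr (A - B) = \tr A - \tr B.
Proof. exact: raddfB. Qed.

(** With [S] the inverse square root of [B] and [w = v *m S], the inverse of [B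
    + outer v] is [S * G * S] for [G] the inverse of [1 + outer w]. The
    Lieb-Thirring inequality separates [G ^+ p] from the power of the resolvent.
    Then [G ^+ p = 1 - g *: outer w], where [g], a sum of [p] powers of [1 / (1
    + sqnorm w)] with exponents at most [p], is at least [kappa * p] because [p
    * sqnorm w <= 1 - kappa]. *)
Lemma resolvent_rank_one_update B (L M kappa : C) v k :
  selfadjoint B -> mx_ge B L -> 0 < L -> 0 <= kappa ->
  sqnorm v <= M -> (2 ^ k)%:R * M <= (1 - kappa) * L ->
  \tr (invmx (B + outer v) ^+ (2 ^ k)) <=
    \tr (invmx B ^+ (2 ^ k)) - kappa * (2 ^ k)%:R * qform (invmx B ^+ (2 ^ k).+1) v.
Proof.
move=> hB + L0 k0 vM pM; have [P [d [uP dR ->]]] := selfadjoint_spectral hB.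
move=> /(mx_geP _ _ uP) Ld; have d0 i : 0 < d 0 i by apply: lt_le_trans (Ld i).
set p := (2 ^ k)%N in pM *.
pose F := spectral_fun P d; pose S := F (fun x => (sqrtC x)^-1).
pose T := F sqrtC; pose R := F (fun x => x^-1).
have sqrtd0 i : 0 < sqrtC (d 0 i) by rewrite sqrtC_gt0.
have conj_sqrt i : (sqrtC (d 0 i))^* = sqrtC (d 0 i).
  by apply/CrealP; rewrite gtr0_real.
have TT : T * T = F id.
  by rewrite /T /F spectral_funM //; apply: eq_spectral_fun => i; rewrite -expr2 sqrtCK.
have F1 : F (fun=> 1) = 1 by rewrite /F spectral_fun_cst.
have TS : T * S = 1.
  rewrite /T /S /F spectral_funM // -F1; apply: eq_spectral_fun => i.
  by rewrite mulfV // gt_eqF.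
have ST : S * T = 1.
  rewrite /T /S /F spectral_funM // -F1; apply: eq_spectral_fun => i.
  by rewrite mulVf // gt_eqF.
have SS : S * S = R.
  rewrite /R /S /F spectral_funM //; apply: eq_spectral_fun => i.
  by rewrite -invfM -expr2 sqrtCK.
have hS : S^t* = S.
  by apply: trC_spectral_fun => i; rewrite fmorphV; congr (_^-1); exact: conj_sqrt.
have hT : T^t* = T by apply: trC_spectral_fun => i; exact: conj_sqrt.
have hR : R^t* = R.
  by apply: trC_spectral_fun => i; rewrite fmorphV; congr (_^-1); exact/CrealP.
have -> : invmx (F id) = R.
  by rewrite /F invmx_spectral_fun // => i; rewrite gt_eqF.
pose w := v *m S; pose a := (1 + sqnorm w)^-1; pose G := 1 - a *: outer w.
have vw : v = w *m T by rewrite /w -mulmxA -[S *m T]/(S * T) ST mulmx1.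
have w1 : 1 + sqnorm w != 0 by rewrite gt_eqF // ltr_pwDl // sqnorm_ge0.
have outer_vw : outer v = T * outer w * T.
  rewrite /outer {1 2}vw trCmx_mul hT -[RHS]/(T *m _ *m T).
  by rewrite !mulmxA.
have GV : (1 + outer w) * G = 1.
  rewrite /G mulrBr mulr1 mulrDl mul1r -scalerAr outerM scalerA -scalerDl.
  have -> : a + a * sqnorm w = 1 by rewrite /a; field.
  by rewrite scale1r addrK.
have BV : (F id + outer v) * (S * G * S) = 1.
  have -> : F id + outer v = T * (1 + outer w) * T.
    by rewrite mulrDr mulrDl mulr1 TT outer_vw.
  have assoc (a1 a2 a3 a4 : 'M[C]_n.+1) :
      a1 * a2 * a1 * (a3 * a4 * a3) = a1 * (a2 * (a1 * a3) * a4) * a3.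
    by rewrite !mulrA.
  by rewrite assoc TS mulr1 GV mulr1.
have -> : invmx (F id + outer v) = S * G * S.
  have [fU _] := mulmx1_unit BV.
  by rewrite -[LHS]mulmx1 -[1%:M]/1 -BV -[_ * (_ * _)]/(_ *m _) mulKmx.
have hG : G^t* = G.
  rewrite /G linearB linearZ /= map_mxB map_mxZ trmx1 map_mx1 /=.
  congr (_ - _ *: _); last exact: trC_outer.
  by apply/CrealP; rewrite realV realD ?real1 // ger0_real // sqnorm_ge0.
rewrite -(mulrA S) (mxtrace_expMC S) -(mulrA G) SS.
apply: le_trans (lieb_thirring_pow2 _ hG hR) _; rewrite -/p.
rewrite sub_outerX -/a mulrBl mul1r -scalerAl mxtraceB mxtraceZ lerD2l lerN2.
rewrite mxtrace_outerM.
have -> : qform (R ^+ p) w = qform (R ^+ p.+1) v.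
  have assoc (A1 A2 : 'M[C]_n.+1) (x : 'rV_n.+1) (y : 'cV_n.+1) :
      x *m A1 *m A2 *m (A1 *m y) = x *m (A1 * A2 * A1) *m y.
    by rewrite -[A1 * A2 * A1]/(A1 *m A2 *m A1) !mulmxA.
  rewrite /qform /w trCmx_mul hS assoc; congr ((v *m _ *m _) 0 0).
  rewrite /R /S /F !spectral_funX // !spectral_funM //; apply: eq_spectral_fun => i.
  by rewrite mulrAC -invfM -expr2 sqrtCK exprS.
apply: ler_wpM2r.
  rewrite /R /F spectral_funX // qform_spectral_fun // sumr_ge0 // => i _.
  by rewrite mulr_ge0 ?exprn_ge0 // invr_ge0 ltW.
have w0 := sqnorm_ge0 w.
have a0 : 0 <= a by rewrite invr_ge0 addr_ge0.
have a1 : a <= 1 by rewrite invf_le1 ?lerDl // ltr_pwDl.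
have kap : kappa <= a ^+ p.
  apply: le_trans (bernoulli_inv p w0).
  rewrite lerBrDr -lerBrDl -(ler_pM2r L0); apply: le_trans pM.
  rewrite -mulrA ler_wpM2l //; apply: le_trans vM.
  have -> : sqnorm w = qform R v.
    by rewrite /qform -SS /sqnorm /w trCmx_mul hS -[S * S]/(S *m S) !mulmxA.
  rewrite /R /F qform_spectral_fun // (sqnorm_spectral d uP) mulr_suml.
  apply: ler_sum => i _; rewrite mulrAC -[X in _ <= X]mul1r ler_wpM2r ?exprn_ge0 //.
  by rewrite mulrC ler_pdivrMr // mul1r.
have -> : kappa * p%:R = \sum_(i < p) kappa by rewrite sumr_const card_ord mulr_natr.
apply: ler_sum => i _; apply: le_trans kap _.
exact: ler_wiXn2l.
Qed.

(** How a bound on the potential is used: each term [x^-p] of the trace is at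
    most the whole trace, so every eigenvalue [x] exceeds [s]. *)
Lemma mxtrace_resolvent_gt B (s L : C) p : selfadjoint B -> mx_ge B L -> 0 < L ->
  0 < s -> (0 < p)%N -> \tr (invmx B ^+ p) < (s^-1) ^+ p -> mx_ge B s.
Proof.
move=> hB + L0 s0 p0; have [P [d [uP dR ->]]] := selfadjoint_spectral hB.
move=> /(mx_geP _ _ uP) Ld; have d0 i : 0 < d 0 i by apply: lt_le_trans (Ld i).
rewrite invmx_spectral_fun //; last by move=> i; rewrite gt_eqF.
rewrite spectral_funX // mxtrace_spectral_fun // => tr_lt.
apply/(mx_geP _ _ uP) => i.
rewrite real_leNgt ?gtr0_real //; apply/negP => dis.
move: tr_lt; rewrite (bigD1 i) //= => tr_lt.
have : (d 0 i)^-1 ^+ p < s^-1 ^+ p.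
  apply: le_lt_trans tr_lt; rewrite lerDl sumr_ge0 // => j _.
  by rewrite exprn_ge0 // invr_ge0 ltW.
rewrite ltr_pXn2r // ?nnegrE ?invr_ge0 ?ltW // ltf_pV2 ?posrE // => sd.
by have := lt_trans sd dis; rewrite ltxx.
Qed.

Lemma outer_ge0 v u : 0 <= qform (outer v) u.
Proof.
rewrite /qform /outer !mulmxA -(mulmxA (u *m _)).
have -> : v *m u^t* = (u *m v^t*)^t* by rewrite trCmx_mul trmxCK.
by rewrite mxE big_ord1 !mxE -normCK exprn_ge0.
Qed.

Lemma mx_geD A B a b : mx_ge A a -> mx_ge B b -> mx_ge (A + B) (a + b).
Proof.
move=> Aa Bb u; rewrite mulrDl /qform mulmxDr mulmxDl mxE.
exact: lerD (Aa u) (Bb u).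
Qed.

Lemma mx_ge_scalar a : mx_ge (a%:M) a.
Proof. by move=> u; rewrite /qform mul_mx_scalar -scalemxAl mxE. Qed.

End Resolvent.

Section ResolventPositivity.
Variables (C : numClosedFieldType) (n : nat).
Implicit Types (B : 'M[C]_n.+1).

Lemma mx_ge_unit B (L : C) : selfadjoint B -> mx_ge B L -> 0 < L -> B \in unitmx.
Proof.
move=> hB + L0; have [P [d [uP dR ->]]] := selfadjoint_spectral hB.
move=> /(mx_geP _ _ uP) Ld.
have d0 i : d 0 i != 0 by rewrite gt_eqF // (lt_le_trans L0 (Ld i)).
have e : spectral_fun P d id * spectral_fun P d (fun x => x^-1) = 1.
  rewrite spectral_funM // -[1]/(1%:M) -(spectral_fun_cst d uP 1).
  by apply: eq_spectral_fun => i; rewrite mulfV.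
by have [] := mulmx1_unit e.
Qed.

Lemma mxtrace_resolvent_ge0 B (L : C) p : selfadjoint B -> mx_ge B L -> 0 < L ->
  0 <= \tr (invmx B ^+ p).
Proof.
move=> hB + L0; have [P [d [uP dR ->]]] := selfadjoint_spectral hB.
move=> /(mx_geP _ _ uP) Ld; have d0 i : 0 < d 0 i by apply: lt_le_trans (Ld i).
rewrite invmx_spectral_fun //; last by move=> i; rewrite gt_eqF.
rewrite spectral_funX // mxtrace_spectral_fun // sumr_ge0 // => i _.
by rewrite exprn_ge0 // invr_ge0 ltW.
Qed.

Lemma selfadjointD A B : selfadjoint A -> selfadjoint B -> selfadjoint (A + B).
Proof. by move=> hA hB; rewrite /selfadjoint linearD /= map_mxD hA hB. Qed.

Lemma selfadjoint_scalar (a : C) : a \is Num.real -> selfadjoint (a%:M : 'M[C]_n.+1).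
Proof.
by move=> /CrealP aR; rewrite /selfadjoint tr_scalar_mx map_scalar_mx /= aR.
Qed.

Lemma qformE B (v : 'rV[C]_n.+1) :
  qform B v = \sum_i \sum_j v 0 i * B i j * (v 0 j)^*.
Proof.
rewrite /qform mxE exchange_big /=; apply: eq_bigr => j _.
by rewrite !mxE mulr_suml.
Qed.

End ResolventPositivity.

Lemma scalar_mxX (K : comNzRingType) n (a : K) q :
  (a%:M : 'M[K]_n.+1) ^+ q = (a ^+ q)%:M.
Proof.
elim: q => [|q IH]; first by rewrite !expr0.
by rewrite !exprS IH scalar_mxM.
Qed.

Local Open Scope classical_set_scope.
Local Open Scope complex_scope.
Local Open Scope ring_scope.

(** * Product laws on tuples and independence *)

Section TupleProbability.
Context {disp : measure_display} {T : measurableType disp} {R : realType}.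

Definition tuple_cons n (z : T * n.-tuple T) : n.+1.-tuple T :=
  [the n.+1.-tuple T of z.1 :: z.2].

Lemma measurable_tuple_cons n : measurable_fun [set: T * n.-tuple T] (@tuple_cons n).
Proof. exact: measurable_cons. Qed.

HB.instance Definition _ n := isMeasurableFun.Build _ _ _ _ (@tuple_cons n)
  (@measurable_tuple_cons n).

(** The product of the laws [mu i], built by prepending one coordinate at a time
    so that integrals unfold by Tonelli's theorem. *)
Fixpoint tuple_prob (n : nat) : ('I_n -> probability T R) -> probability (n.-tuple T) R :=
  match n with
  | 0%N => fun=> dirac [tuple]
  | m.+1 => fun mu =>
      distribution (mu ord0 \x tuple_prob (fun i => mu (lift ord0 i)))%E (@tuple_cons m)
  end.

Lemma ge0_integral_tuple_prob n (mu : 'I_n.+1 -> probability T R)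
    (f : n.+1.-tuple T -> \bar R) :
  measurable_fun [set: n.+1.-tuple T] f -> (forall v, 0 <= f v)%E ->
  (\int[tuple_prob mu]_v f v =
   \int[mu ord0]_x \int[tuple_prob (fun i => mu (lift ord0 i))]_v f (tuple_cons (x, v)))%E.
Proof.
move=> mf f0; rewrite /= ge0_integral_distribution //.
rewrite fubini_tonelli1 //; last by move=> x; exact: f0.
exact: measurableT_comp.
Qed.

Definition box n (A : 'I_n -> set T) : set (n.-tuple T) :=
  [set v | forall i, A i (tnth v i)].

Lemma measurable_box n (A : 'I_n -> set T) :
  (forall i, measurable (A i)) -> measurable (box A).
Proof.
move=> mA; have -> : box A = \bigcap_(i in [set: 'I_n]) ((@tnth _ T ^~ i) @^-1` A i).
  by apply/seteqP; split => [v + i _|v + i]; exact.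
apply: fin_bigcap_measurable => // i _.
by rewrite -[X in measurable X]setTI; exact: measurable_tnth.
Qed.

Lemma tuple_prob_box n (mu : 'I_n -> probability T R) (A : 'I_n -> set T) :
  (forall i, measurable (A i)) ->
  tuple_prob mu (box A) = (\prod_(i < n) mu i (A i))%E.
Proof.
elim: n mu A => [|n IH] mu A mA.
  rewrite big_ord0 /= diracE; have -> : [tuple] \in box A by rewrite inE => -[].
  by [].
rewrite big_ord_recl /= -IH // /distribution /pushforward.
rewrite -product_measure1E //; last exact: measurable_box.
congr (_ _); apply/seteqP; split => [[x v] /= xvA|[x v] /= [xA vA] i].
  split; first by have := xvA ord0.
  by move=> i; have := xvA (lift ord0 i); rewrite tnthS.
have [j ->|->] := unliftP ord0 i; last exact: xA.
by rewrite tnthS; exact: vA.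
Qed.

(** Boxes form a pi-system that generates the sigma-algebra of the tuples. *)
Lemma tuple_prob_unique n (mu : 'I_n -> probability T R)
    (m : {measure set (n.-tuple T) -> \bar R}) :
  (forall A : 'I_n -> set T, (forall i, measurable (A i)) ->
    m (box A) = (\prod_(i < n) mu i (A i))%E) ->
  forall A, measurable A -> m A = tuple_prob mu A.
Proof.
move=> mE; pose G := [set B | exists2 A : 'I_n -> set T,
  (forall i, measurable (A i)) & B = box A].
apply: (measure_unique G (fun=> setT)).
- apply/seteqP; split.
    apply: smallest_sub => [|B]; first exact: smallest_sigma_algebra.
    rewrite -bigcup_seq /= => -[i /= _ [C mC <-]].
    apply: sub_sigma_algebra; exists (fun j => if j == i then C else setT).
      by move=> j; case: ifP.
    rewrite setTI; apply/seteqP; split => [v Cv j|v /(_ i)]; last by rewrite eqxx.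
    by case: eqP => // ->.
  apply: smallest_sub => [|B [A mA ->]]; first exact: sigma_algebra_measurable.
  exact: measurable_box.
- move=> _ _ [A mA ->] [B mB ->]; exists (fun i => A i `&` B i).
    by move=> i; exact: measurableI.
  apply/seteqP; split => [v [Av Bv] i|v AB]; first by split.
  by split => i; have [] := AB i.
- by move=> _; exists (fun=> setT) => //; apply/seteqP; split.
- by rewrite bigcup_const.
- by move=> _ [A mA ->]; rewrite mE //; exact: esym (tuple_prob_box mu mA).
- move=> _; have := mE (fun=> setT) (fun=> measurableT).
  have -> : box (fun=> setT) = [set: n.-tuple T] by apply/seteqP; split.
  move=> ->; rewrite big1 ?ltry // => i _; exact: probability_setT.
Qed.

End TupleProbability.

Section Independence.
Context {disp disp' : measure_display} {T : measurableType disp'} {R : realType}.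
Context {Omega : measurableType disp} (P : probability Omega R).
Variables (n : nat) (X : 'I_n -> {RV P >-> T}).

Definition joint (w : Omega) : n.-tuple T := [tuple X i w | i < n].

Lemma measurable_joint : measurable_fun setT joint.
Proof.
apply/measurable_fun_tnthP => i.
have -> : (@tnth n T)^~ i \o joint = X i by apply/funext => w /=; rewrite tnth_mktuple.
exact: measurable_funP.
Qed.

HB.instance Definition _ := isMeasurableFun.Build _ _ _ _ joint measurable_joint.

(** Mutual independence, applied to the family of all indices, gives the
    probability of every box. *)
Lemma joint_law : mutually_independent X -> forall A, measurable A ->
  distribution P joint A = tuple_prob (fun i => distribution P (X i)) A.
Proof.
move=> indX; apply: tuple_prob_unique => A mA.
have := indX [set: 'I_n]%SET A mA.
rewrite (eq_bigl xpredT) => [<-|i]; last by rewrite inE.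
rewrite /= /distribution /pushforward.
congr (P _); apply/seteqP; split => [w bw i _|w bw i].
  by have := bw i; rewrite tnth_mktuple.
by rewrite tnth_mktuple; apply: bw => /=; rewrite finset.in_setT.
Qed.

Lemma ge0_integral_joint (f : n.-tuple T -> \bar R) : mutually_independent X ->
  measurable_fun [set: n.-tuple T] f -> (forall v, 0 <= f v)%E ->
  (\int[P]_w f (joint w) =
   \int[tuple_prob (fun i => distribution P (X i))]_v f v)%E.
Proof.
move=> indX mf f0; rewrite -[LHS](ge0_integral_distribution joint mf f0).
by apply: eq_measure_integral => A mA _; exact: joint_law.
Qed.

End Independence.

(** * Potentials along independent samples *)

Section Potential.
Context {disp : measure_display} {T : measurableType disp} {R : realType}.
Variables (S : Type) (upd : T -> S -> S) (psi : nat -> S -> R).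
Variable Inv : nat -> S -> Prop.

Definition run (s : S) (v : seq T) : S := foldl (fun s x => upd x s) s v.

Hypothesis psi_ge0 : forall n s, Inv n s -> 0 <= psi n s.
Hypothesis Inv_upd : forall n s x, Inv n.+1 s -> Inv n (upd x s).
Hypothesis measurable_upd : forall n s, Inv n.+1 s ->
  measurable_fun setT (fun x => psi n (upd x s)).
Hypothesis measurable_run : forall n s, Inv n s ->
  measurable_fun [set: n.-tuple T] (fun v : n.-tuple T => psi 0%N (run s v)).

(** A supermartingale argument without conditional expectations. The state [s]
    moves to [upd x s] when the sample [x] arrives, [psi m] is the potential of
    a state when [m] samples are still to come, and [Inv m] collects the states
    in which the one-step estimate holds. By Tonelli's theorem the first sample
    is the last one to be integrated, so the induction on the number of samples
    treats a deterministic state. *)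
Lemma potential_le n (mu : 'I_n -> probability T R) (s : S) :
  (forall i m s', Inv m.+1 s' ->
     (\int[mu i]_x (psi m (upd x s'))%:E <= (psi m.+1 s')%:E)%E) ->
  Inv n s ->
  (\int[tuple_prob mu]_v (psi 0%N (run s (v : n.-tuple T)))%:E <= (psi n s)%:E)%E.
Proof.
have run_ge0 m s' (v : m.-tuple T) : Inv m s' -> 0 <= psi 0%N (run s' v).
  elim: m s' v => [|m IH] s' v Is'; first by rewrite tuple0; exact: psi_ge0.
  by case/tupleP: v => x v; apply: IH; exact: Inv_upd.
elim: n mu s => [|n IH] mu s mu_step Is.
  rewrite /= integral_dirac //; first by rewrite diracT mul1e.
  apply/measurable_EFinP; exact: measurable_run.
pose f (v : n.+1.-tuple T) := (psi 0%N (run s v))%:E.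
pose Pos (v : n.+1.-tuple T) := run_ge0 _ _ v Is.
rewrite ge0_integral_tuple_prob; last 2 first.
- by apply/measurable_EFinP; exact: measurable_run.
- by move=> v; rewrite lee_fin; exact: Pos.
apply: le_trans (mu_step ord0 n s Is).
apply: ge0_le_integral => //.
- by move=> x _; apply: integral_ge0 => v _; rewrite lee_fin; exact: Pos (tuple_cons (x, v)).
- apply: (measurable_fun_fubini_tonelli_F (f \o @tuple_cons _ _ n)).
  + by apply: measurableT_comp => //; apply/measurable_EFinP; exact: measurable_run.
  + by move=> z; exact: Pos (tuple_cons z).
- by apply/measurable_EFinP; exact: measurable_upd.
- move=> x _; apply: (IH (fun i => mu (lift ord0 i)) (upd x s)); last exact: Inv_upd.
  by move=> i; exact: mu_step.
Qed.

End Potential.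

(** Markov's inequality. *)
Lemma prob_exceeds_of_integral disp (Omega : measurableType disp) (R : realType)
    (P : probability Omega R) (Y : Omega -> R) (b eps thr : R) :
  measurable_fun setT Y -> (forall w, 0 <= Y w) ->
  (\int[P]_w (Y w)%:E <= b%:E)%E -> 0 < thr -> b < eps * thr ->
  prob_exceeds P (1 - eps) (fun w => Y w < thr).
Proof.
move=> mY Y0 Yb thr0 b_lt.
have mge : measurable [set w | thr <= Y w].
  have -> : [set w | thr <= Y w] = setT `&` Y @^-1` `[thr, +oo[%classic.
    by rewrite setTI; apply/seteqP; split=> w /=; rewrite in_itv /= andbT.
  exact: mY.
exists (~` [set w | thr <= Y w]); split; first exact: measurableC.
  by move=> w /= /negP; rewrite -ltNge.
have Pfin : P [set w | thr <= Y w] \is a fin_num by exact: fin_num_measure.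
rewrite probability_setC // -(fineK Pfin) -EFinB lte_fin ltrD2l ltrN2.
have markov_ineq : (thr%:E * P [set w | (thr <= Y w)%R] <= \int[P]_w (Y w)%:E)%E.
  rewrite -[X in P X]setIT -integral_indic // -ge0_integralZl //; last 2 first.
  - exact/measurable_EFinP/measurable_indic.
  - by rewrite lee_fin ltW.
  apply: ge0_le_integral => //.
  - by move=> w _; rewrite mule_ge0 // lee_fin ltW.
  - apply/measurable_EFinP; apply: measurable_funM => //; exact: measurable_indic.
  - exact/measurable_EFinP.
  - move=> w _; rewrite -EFinM lee_fin indicE.
    have [/set_mem|_] := boolP (w \in _); first by rewrite mulr1.
    by rewrite mulr0.
move: markov_ineq; rewrite -[X in (_ * X)%E](fineK Pfin) -EFinM => /le_trans/(_ Yb).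
rewrite lee_fin => /le_lt_trans /(_ b_lt).
by rewrite mulrC ltr_pM2r.
Qed.

Lemma prob_exceedsW disp (Omega : measurableType disp) (R : realType)
    (P : probability Omega R) (a : R) (Q1 Q2 : Omega -> Prop) :
  (forall w, Q1 w -> Q2 w) -> prob_exceeds P a Q1 -> prob_exceeds P a Q2.
Proof. by move=> Q12 [E [mE EQ PE]]; exists E; split=> // w /EQ/Q12. Qed.

Lemma prob_exceeds_sure disp (Omega : measurableType disp) (R : realType)
    (P : probability Omega R) (eps : R) (Q : Omega -> Prop) :
  0 < eps -> (forall w, Q w) -> prob_exceeds P (1 - eps) Q.
Proof.
move=> eps0 allQ; exists setT; split=> //.
by rewrite probability_setT lte_fin ltrBlDr ltrDl.
Qed.

(** * Orthogonality of the characters under the two sampling models *)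

Section Phases.
Context {R : realType}.
Local Notation TR := (measurableTypeR R).

Definition phase d (m : d.-tuple int) (v : d.-tuple R) : R :=
  \sum_(i < d) (tnth m i)%:~R * tnth v i.

Lemma measurable_phase d (m : d.-tuple int) :
  measurable_fun [set: d.-tuple TR] (phase m : d.-tuple TR -> R).
Proof.
apply: measurable_sum => i.
by apply: measurable_funM => //; exact: (measurable_tnth (T := TR)).
Qed.

(** The function [exp (i h)] has mean zero. The formulation with [1 + cos] and
    an arbitrary phase [a] only involves integrals of nonnegative functions, to
    which Tonelli's theorem applies directly; the phase makes it cover the sine
    as well. *)
Definition cancelling disp (T : measurableType disp) (mu : probability T R)
    (h : T -> R) :=
  forall a : R, (\int[mu]_x (1 + cos (a + h x))%:E = 1)%E.

Lemma measurable_1Dcos disp (T : measurableType disp) (h : T -> R) (a : R) :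
  measurable_fun setT h -> measurable_fun setT (fun x => (1 + cos (a + h x))%:E).
Proof.
move=> mh; apply/measurable_EFinP; apply: measurable_funD => //.
have mcos : measurable_fun setT (@cos R).
  by apply: continuous_measurable_fun; exact: continuous_cos.
by apply: (measurableT_comp mcos); exact: measurable_funD.
Qed.

Lemma oneDcos_ge0 (t : R) : (0 <= (1 + cos t)%:E)%E.
Proof. by rewrite lee_fin -lerBlDl sub0r cos_geN1. Qed.

(** Integrating out the first coordinate adds [m0 * t] to the phase [a]. If the
    remaining frequency is nonzero, the inner integral is already [1] whatever
    the phase; otherwise the integrand depends on the first coordinate only. The
    set [Q] is the range of frequencies which the one-dimensional law
    distinguishes. *)
Lemma cancelling_tuple_prob (rho : probability TR R) (Q : set int) :
  (forall m, Q m -> m != 0 -> cancelling rho (fun t => m%:~R * t)) ->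
  forall d (m : d.-tuple int), (forall i, Q (tnth m i)) ->
  (exists i, tnth m i != 0) ->
  cancelling (tuple_prob (fun _ : 'I_d => rho)) (phase m).
Proof.
move=> rhoQ; elim=> [m _ [[]]//|d IH m Qm [i0 mi0] a].
rewrite ge0_integral_tuple_prob; last 2 first.
- by apply: measurable_1Dcos; exact: measurable_phase.
- by move=> v; exact: oneDcos_ge0.
case/tupleP: m Qm mi0 => m0 m Qm mi0.
have phaseE t (v : d.-tuple TR) : phase [tuple of m0 :: m] (tuple_cons (t, v))
    = m0%:~R * t + phase m v.
  rewrite /phase big_ord_recl !tnth0; congr (_ + _).
  by apply: eq_bigr => i _; rewrite !tnthS.
under eq_integral do under eq_integral do rewrite phaseE addrA.
have [/existsP [i mi]|] := boolP [exists i, tnth m i != 0].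
  under eq_integral => t _.
    rewrite IH; last by exists i.
      over.
    by move=> j; have := Qm (lift ord0 j); rewrite tnthS.
  by rewrite integral_cst // mul1e; exact: probability_setT.
rewrite negb_exists => /forallP m_eq0.
have m00 : m0 != 0.
  move: mi0; have [j ->|->] := unliftP ord0 i0; last by rewrite tnth0.
  by rewrite tnthS (negbTE (m_eq0 j)).
under eq_integral => t _.
  under eq_integral => v _.
    rewrite /phase big1; last first.
      by move=> j _; have := m_eq0 j; rewrite negbK => /eqP ->; rewrite mul0r.
    rewrite addr0; over.
  rewrite integral_cst // [X in (_ * X)%E](_ : _ = 1%E); last exact: probability_setT.
  rewrite mule1; over.
by apply: rhoQ => //; have := Qm ord0; rewrite tnth0.
Qed.

Lemma is_derive_primitive_1Dcos (a m t : R) : m != 0 ->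
  is_derive t 1 (fun s : R => s + sin (a + m * s) / m) (1 + cos (a + m * t)).
Proof.
move=> m0.
have dlin : is_derive t 1 (fun s : R => a + m * s) m.
  have -> : (fun s : R => a + m * s) = cst a + m \*: id by [].
  apply: is_derive_eq.
  by rewrite add0r [_ *: _]mulr1.
have dsin := @is_derive1_comp _ (@sin R) (fun s => a + m * s) t _ _ (is_derive_sin _) dlin.
have -> : (fun s : R => s + sin (a + m * s) / m)
    = id + m^-1 \*: (sin \o (fun s => a + m * s)).
  by apply/funext => s; rewrite [_ / m]mulrC.
apply: is_derive_eq.
by rewrite [_ *: _]mulrC mulfK.
Qed.

Lemma sinD_intr2pi (x : R) (m : int) : sin (x + m%:~R * (2 * pi)) = sin x.
Proof.
have E (y : R) (n : nat) : sin (y + n%:R * (2 * pi)) = sin y.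
  by rewrite mulr_natl mulr_natl; exact: (periodicn (@sinD2pi R)).
case: m => n; first exact: E.
by rewrite NegzE mulrNz mulNr -(E (x - _) n.+1) subrK.
Qed.

Lemma two_pi_gt0 : 0 < 2 * pi :> R.
Proof. by rewrite mulr_gt0 ?pi_gt0. Qed.

Definition circle_uniform : probability TR R := uniform_prob two_pi_gt0.

Lemma cancelling_circle_uniform (m : int) : m != 0 ->
  cancelling circle_uniform (fun t => m%:~R * t).
Proof.
move=> m0 a; have mR0 : m%:~R != 0 :> R by rewrite intr_eq0.
rewrite /circle_uniform integral_uniform; last 2 first.
- by apply: measurable_1Dcos; exact: measurable_funM.
- by move=> t; exact: oneDcos_ge0.
pose F (t : R) := t + sin (a + m%:~R * t) / m%:~R.
have dF (t : R) : is_derive t (1 : R) F (1 + cos (a + m%:~R * t)).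
  exact: is_derive_primitive_1Dcos.
have cF : continuous F.
  by move=> t; apply/differentiable_continuous/derivable1_diffP; have [] := dF t.
have cf : continuous (fun t : R => 1 + cos (a + m%:~R * t)).
  move=> t; apply: cvgD; first exact: cvg_cst.
  apply: (@continuous_comp _ _ _ (fun t : R => a + m%:~R * t) (@cos R)).
    apply: cvgD; first exact: cvg_cst.
    by apply: cvgM; [exact: cvg_cst|exact: cvg_id].
  exact: continuous_cos.
rewrite (@continuous_FTC2 _ (fun t => 1 + cos (a + m%:~R * t)) F) ?two_pi_gt0 //.
- rewrite /F mulr0 addr0 add0r sinD_intr2pi.
  rewrite -EFinB addrK subr0 -EFinM mulVf // gt_eqF //; exact: two_pi_gt0.
- exact: continuous_subspaceT.
- split; first by move=> t _; have [] := dF t.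
    by apply: cvg_at_right_filter; exact: cF.
  by apply: cvg_at_left_filter; exact: cF.
- by move=> t _; rewrite derive1E; have [_ ->] := dF t.
Qed.

End Phases.

Section Grid.
Context {R : realType}.
Local Notation TR := (measurableTypeR R).
Variable q : nat.

(** The number of grid points in each direction is [q.+1], so that it is
    positive. *)
Definition grid_value (k : nat) : R := 2 * pi * k%:R / q.+1%:R.

Lemma grid_weight_ge0 : 0 <= q.+1%:R^-1 :> R.
Proof. by rewrite invr_ge0. Qed.

Definition grid_weight : {nonneg R} := NngNum grid_weight_ge0.

Definition grid_measure : set TR -> \bar R :=
  mscale grid_weight (msum (fun k => dirac (grid_value k : TR)) q.+1).

HB.instance Definition _ := Measure.on grid_measure.

Lemma grid_measureE (A : set TR) :
  grid_measure A = ((\sum_(k < q.+1) \1_A (grid_value k)) / q.+1%:R)%:E.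
Proof.
rewrite -[LHS]/(q.+1%:R^-1%:E * \sum_(k < q.+1) (\1_A (grid_value k))%:E)%E.
by rewrite sumEFin -EFinM mulrC.
Qed.

Lemma grid_measureT : grid_measure setT = 1%:E.
Proof.
rewrite grid_measureE; under eq_bigr do rewrite indicT.
by rewrite sumr_const card_ord mulfV.
Qed.

HB.instance Definition _ := Measure_isProbability.Build _ _ _ grid_measure grid_measureT.

Definition grid_uniform : probability TR R := grid_measure.

Lemma grid_uniformE (A : set TR) :
  grid_uniform A = ((\sum_(k < q.+1) \1_A (grid_value k)) / q.+1%:R)%:E.
Proof. exact: grid_measureE. Qed.

Lemma sum_cos_telescope (a b : R) n :
  (\sum_(k < n) cos (a + k%:R * b)) * (2 * sin (b / 2))
    = sin (a + n%:R * b - b / 2) - sin (a - b / 2).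
Proof.
elim: n => [|n IH]; first by rewrite big_ord0 !mul0r addr0 subrr.
rewrite big_ord_recr /= mulrDl IH.
have -> : a + n.+1%:R * b - b / 2 = a + n%:R * b + b / 2 by rewrite -natr1; field.
rewrite sinB [sin (_ + b / 2)]sinD; ring.
Qed.

(** A geometric sum of [q.+1]-th roots of unity. The sum of the cosines is
    multiplied by [2 sin (b / 2)], nonzero because [0 < |m| < q.+1], in order to
    telescope. *)
Lemma cancelling_grid_uniform (m : int) : `|m| < q.+1%:Z -> m != 0 ->
  cancelling grid_uniform (fun t => m%:~R * t).
Proof.
move=> mq m0 a.
have mf : measurable_fun [set: TR] (fun x : TR => (1 + cos (a + m%:~R * x))%:E).
  by apply: measurable_1Dcos; exact: measurable_funM.
have f0 (x : TR) : setT x -> (0 <= (1 + cos (a + m%:~R * x))%:E)%E.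
  by move=> _; exact: oneDcos_ge0.
rewrite (ge0_integral_mscale _ _ _ mf f0) // (ge0_integral_measure_sum _ _ f0) //.
under eq_bigr do rewrite integral_dirac // diracT mul1e.
rewrite sumEFin -EFinM; congr EFin.
rewrite big_split /= sumr_const card_ord.
suff -> : \sum_(i < q.+1) cos (a + m%:~R * grid_value i) = 0.
  by rewrite addr0 mulVf.
pose b : R := m%:~R * (2 * pi) / q.+1%:R.
have sb : sin (b / 2) != 0.
  have -> : b / 2 = m%:~R * (pi / q.+1%:R) by rewrite /b; field; rewrite addrC natr1.
  have x0 : 0 < `|m|%:~R * (pi / q.+1%:R) :> R.
    by rewrite mulr_gt0 ?ltr0z ?normr_gt0 // divr_gt0 ?pi_gt0.
  have x1 : `|m|%:~R * (pi / q.+1%:R) < pi :> R.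
    rewrite mulrCA -[X in _ < X]mulr1 ltr_pM2l ?pi_gt0 //.
    by rewrite ltr_pdivrMr // mul1r -[X in _ < X]/(q.+1%:Z%:~R) ltr_int.
  have /lt0r_neq0 : 0 < sin (`|m|%:~R * (pi / q.+1%:R)) :> R.
    by apply: sin_gt0_pi; rewrite x0.
  have [mge|mlt] := leP 0 m; first by rewrite ger0_norm.
  by rewrite ltr0_norm // mulrNz mulNr sinN oppr_eq0.
apply: (mulIf (mulf_neq0 (lt0r_neq0 (ltr0Sn R 1)) sb)); rewrite mul0r.
under eq_bigr => i _.
  have -> : a + m%:~R * grid_value i = a + i%:R * b.
    by rewrite /grid_value /b; congr (_ + _); rewrite !mulrA [RHS]mulrC; field.
  over.
rewrite sum_cos_telescope.
have -> : a + q.+1%:R * b - b / 2 = a - b / 2 + m%:~R * (2 * pi).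
  rewrite /b; field; by rewrite addrC natr1.
by rewrite sinD_intr2pi subrr.
Qed.
End Grid.

Section Laws.
Context {R : realType}.
Local Notation TR := (measurableTypeR R).

(** Boxes are the only sets on which the iterated integral has to be evaluated:
    a law that agrees with a product law on boxes is that product law. *)
Lemma lebesgue_tuple_box d (A : 'I_d -> set TR) : (forall i, measurable (A i)) ->
  lebesgue_tuple (box A : set (d.-tuple R)) = (\prod_(i < d) lebesgue_measure (A i))%E.
Proof.
elim: d A => [|d IH] A mA.
  rewrite big_ord0 /= indicE; have -> // : [tuple] \in box A by rewrite inE => -[].
rewrite big_ord_recl /=.
transitivity (\int[lebesgue_measure]_(t in [set: R])
   ((\1_(A ord0) t)%:E * \prod_(i < d) lebesgue_measure (A (lift ord0 i))))%E.
  apply: eq_integral => t _; rewrite indicE.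
  have [tA|tA] := boolP (t \in A ord0).
    rewrite mul1e -IH //; congr lebesgue_tuple; apply/seteqP.
    split=> [v vA i|v vA i]; first by have := vA (lift ord0 i); rewrite tnthS.
    have [j ->|->] := unliftP ord0 i; last by rewrite tnth0; exact/set_mem.
    by rewrite tnthS; exact: vA.
  rewrite mul0e; transitivity (lebesgue_tuple (set0 : set (d.-tuple R))).
    congr lebesgue_tuple; apply/seteqP; split=> // v /(_ ord0).
    by rewrite tnth0 => /mem_set; rewrite (negbTE tA).
  elim: (d) => [|d' IHd] /=; first by rewrite indic0.
  by rewrite integral0_eq // => x _; exact: IHd.
rewrite ge0_integralZr //.
- by rewrite integral_indic // setIT.
- exact/measurable_EFinP/measurable_indic.
- by apply: prode_ge0.
Qed.

Lemma circle_uniformE (A : set TR) : measurable A ->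
  circle_uniform A = ((2 * pi)^-1%:E * lebesgue_measure (A `&` `[0%R, (2 * pi)%R]%classic))%E.
Proof.
move=> mA; rewrite -[A in LHS]setIT -integral_indic // integral_uniform.
- by rewrite subr0 integral_indic //.
- exact/measurable_EFinP/measurable_indic.
- by move=> x; rewrite lee_fin.
Qed.

Lemma indic_box d (A : 'I_d -> set TR) (v : d.-tuple R) :
  \1_(box A : set (d.-tuple TR)) v = \prod_(i < d) (\1_(A i) (tnth v i) : R).
Proof.
rewrite indicE; have [/set_mem vA|vA] := boolP (v \in _).
  by rewrite big1 // => i _; rewrite indicE mem_set //; exact: vA.
apply/esym/eqP/prodf_eq0; apply: contrapT => allA; move/negP: vA; apply.
apply: mem_set => i; apply: contrapT => vi; apply: allA.
by exists i => //; rewrite indicE memNset.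
Qed.

Section Models.
Context {disp : measure_display} {Omega : measurableType disp}.
Variable P : probability Omega R.
Variables (d N : nat) (X : 'I_N -> {RV P >-> d.-tuple TR}).

Lemma uniform_on_cubeE : uniform_on_cube X -> forall j A, measurable A ->
  distribution P (X j) A = tuple_prob (fun _ : 'I_d => @circle_uniform R) A.
Proof.
move=> unif j; apply: tuple_prob_unique => A mA.
rewrite -[LHS]/(distribution P (X j) (box A)) unif; last exact: measurable_box.
have -> : box A `&` @cube R d = box (fun i => A i `&` `[0%R, (2 * pi)%R]%classic).
  apply/seteqP; split=> [v [vA vc] i|v vA].
    by split; [exact: vA|rewrite /= in_itv /=; exact: vc].
  split=> i; first by have [] := vA i.
  have [_ vi] := vA i; move: vi; rewrite /= in_itv; exact.
rewrite lebesgue_tuple_box; last by move=> i; exact: measurableI.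
under [RHS]eq_bigr do rewrite circle_uniformE //.
rewrite big_split /=; congr (_ * _)%E.
by rewrite prodEFin prodr_const card_ord exprVn.
Qed.

Lemma uniform_on_gridE q : uniform_on_grid X q.+1 -> forall j A, measurable A ->
  distribution P (X j) A = tuple_prob (fun _ : 'I_d => @grid_uniform R q) A.
Proof.
move=> unif j; apply: tuple_prob_unique => A mA.
rewrite -[LHS]/(distribution P (X j) (box A)) unif; last exact: measurable_box.
under [RHS]eq_bigr do rewrite grid_uniformE.
rewrite prodEFin big_split /= prodr_const card_ord exprVn; congr (_ / _)%:E.
rewrite bigA_distr_bigA /=.
rewrite (reindex (fun f : {ffun 'I_d -> 'I_q.+1} => [tuple f i | i < d])) /=.
  apply: eq_bigr => f _; rewrite indic_box; apply: eq_bigr => i _.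
  by rewrite !tnth_mktuple.
exists (fun a => [ffun i => tnth a i]) => [f _|a _].
  by apply/ffunP => i; rewrite ffunE tnth_mktuple.
by apply/eq_from_tnth => i; rewrite tnth_mktuple ffunE.
Qed.

Definition freq_diff (k l : d.-tuple int) : d.-tuple int :=
  [tuple tnth k i - tnth l i | i < d].

Lemma freq_diff_neq0 k l : k != l -> exists i, tnth (freq_diff k l) i != 0.
Proof.
move=> kl; apply/existsP; apply: contraNT kl.
rewrite negb_exists => /forallP h; apply/eqP/eq_from_tnth => i.
by have := h i; rewrite tnth_mktuple negbK subr_eq0 => /eqP.
Qed.

Lemma eq_law_cancelling (mu nu : probability (d.-tuple TR) R) m :
  (forall A, measurable A -> mu A = nu A) ->
  cancelling nu (phase m) -> cancelling mu (phase m).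
Proof.
move=> munu nuc a; rewrite -[RHS](nuc a).
by apply: eq_measure_integral => A mA _; exact: munu.
Qed.

(** In the first model the coordinates are uniform on a circle, where every
    nonzero frequency cancels. In the second one they are uniform on [q]
    equidistant points; the frequencies have their coordinates between 0 and [q
    - 1], so a nonzero difference of frequencies has a nonzero coordinate of
    absolute value less than [q]. *)
Lemma model_cancelling (Gamma : {fset d.-tuple int}) :
  model1 X \/ model2 X Gamma -> mutually_independent X /\
  forall j (k l : Gamma), k != l ->
    cancelling (distribution P (X j)) (phase (freq_diff (val k) (val l))).
Proof.
case=> [[indX unif]|[q [q0 Gq indX unif]]]; split=> // j k l kl.
- apply: (eq_law_cancelling (uniform_on_cubeE unif j)).
  apply: (@cancelling_tuple_prob _ _ setT) => //.
    by move=> m _; exact: cancelling_circle_uniform.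
  exact: freq_diff_neq0.
- case: q q0 Gq unif => [//|q] _ Gq unif.
  apply: (eq_law_cancelling (uniform_on_gridE unif j)).
  apply: (@cancelling_tuple_prob _ _ [set m | `|m| < q.+1%:Z]).
  + by move=> m mq; exact: cancelling_grid_uniform.
  + move=> i /=; rewrite tnth_mktuple.
    have /andP[k0 kq] := Gq k i; have /andP[l0 lq] := Gq l i.
    rewrite ltr_norml; apply/andP; split.
      by rewrite ltrBrDl (lt_le_trans _ k0) // subr_lt0.
    by rewrite ltrBlDr (lt_le_trans kq) // lerDl.
  + exact: freq_diff_neq0.
Qed.

End Models.

End Laws.

(** * Complex-valued functions: modulus, measurability and integrals of phases *)

Section ComplexMeasurable.
Context {disp : measure_display} {T : measurableType disp} {R : realType}.
Implicit Types f g : T -> R[i].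

Definition cmeasurable f :=
  measurable_fun setT (fun x => complex.Re (f x)) /\
  measurable_fun setT (fun x => complex.Im (f x)).

Lemma cmeasurable_cst (c : R[i]) : cmeasurable (fun=> c).
Proof. by split; exact: measurable_cst. Qed.

Lemma cReD (x y : R[i]) : complex.Re (x + y) = complex.Re x + complex.Re y.
Proof. by case: x y => ? ? []. Qed.
Lemma cImD (x y : R[i]) : complex.Im (x + y) = complex.Im x + complex.Im y.
Proof. by case: x y => ? ? []. Qed.
Lemma cReM (x y : R[i]) : complex.Re (x * y) =
  complex.Re x * complex.Re y - complex.Im x * complex.Im y.
Proof. by case: x y => ? ? []. Qed.
Lemma cImM (x y : R[i]) : complex.Im (x * y) =
  complex.Re x * complex.Im y + complex.Im x * complex.Re y.
Proof. by case: x y => ? ? []. Qed.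

Lemma cmeasurableD f g : cmeasurable f -> cmeasurable g ->
  cmeasurable (fun x => f x + g x).
Proof.
move=> [mf mf'] [mg mg']; split.
  by under eq_fun do rewrite cReD; exact: measurable_funD.
by under eq_fun do rewrite cImD; exact: measurable_funD.
Qed.

Lemma cmeasurableM f g : cmeasurable f -> cmeasurable g ->
  cmeasurable (fun x => f x * g x).
Proof.
move=> [mf mf'] [mg mg']; split.
  by under eq_fun do rewrite cReM; apply: measurable_funB; exact: measurable_funM.
by under eq_fun do rewrite cImM; apply: measurable_funD; exact: measurable_funM.
Qed.

Lemma cmeasurable_conj f : cmeasurable f -> cmeasurable (fun x => (f x)^*%R).
Proof.
move=> [mf mf']; split.
  have -> // : (fun x => complex.Re (f x)^*%R) = (fun x => complex.Re (f x)).
  by apply/funext => x; case: (f x).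
have -> : (fun x => complex.Im (f x)^*%R) = (fun x => - complex.Im (f x)).
  by apply/funext => x; case: (f x).
exact: measurableT_comp.
Qed.

Lemma cmeasurable_sum (I : Type) (s : seq I) (F : I -> T -> R[i]) :
  (forall i, cmeasurable (F i)) -> cmeasurable (fun x => \sum_(i <- s) F i x).
Proof.
move=> mF; elim: s => [|i s IH].
  by under eq_fun do rewrite big_nil; exact: cmeasurable_cst.
by under eq_fun do rewrite big_cons; exact: cmeasurableD.
Qed.

Lemma cmeasurable_prod (I : Type) (s : seq I) (F : I -> T -> R[i]) :
  (forall i, cmeasurable (F i)) -> cmeasurable (fun x => \prod_(i <- s) F i x).
Proof.
move=> mF; elim: s => [|i s IH].
  by under eq_fun do rewrite big_nil; exact: cmeasurable_cst.
by under eq_fun do rewrite big_cons; exact: cmeasurableM.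
Qed.

Lemma cmeasurableV f : cmeasurable f -> cmeasurable (fun x => (f x)^-1).
Proof.
move=> [mf mf'].
pose n2 x := complex.Re (f x) ^+ 2 + complex.Im (f x) ^+ 2.
have n20 x : 0 <= n2 x by rewrite addr_ge0 // sqr_ge0.
have mV : measurable_fun setT (fun x => (n2 x)^-1).
  under eq_fun do rewrite -powR_inv1 //.
  apply: (measurableT_comp (measurable_powR (-1))).
  by apply: measurable_funD; exact: measurable_funX.
split.
  have -> : (fun x => complex.Re (f x)^-1) = (fun x => complex.Re (f x) * (n2 x)^-1).
    by apply/funext => x; rewrite /n2; case: (f x).
  exact: measurable_funM.
have -> : (fun x => complex.Im (f x)^-1) = (fun x => - (complex.Im (f x) * (n2 x)^-1)).
  by apply/funext => x; rewrite /n2; case: (f x).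
apply: measurableT_comp => //; exact: measurable_funM.
Qed.

Section Matrices.
Variables m n p : nat.

Definition mx_measurable k l (A : T -> 'M[R[i]]_(k, l)) :=
  forall i j, cmeasurable (fun x => A x i j).

Lemma mx_measurableM (A : T -> 'M[R[i]]_(m, n)) (B : T -> 'M[R[i]]_(n, p)) :
  mx_measurable A -> mx_measurable B -> mx_measurable (fun x => A x *m B x).
Proof.
move=> mA mB i j; under eq_fun do rewrite mxE.
by apply: cmeasurable_sum => k; exact: cmeasurableM.
Qed.

Lemma cmeasurable_det (A : T -> 'M[R[i]]_n) :
  mx_measurable A -> cmeasurable (fun x => \det (A x)).
Proof.
move=> mA; apply: cmeasurable_sum => s; apply: cmeasurableM.
  exact: cmeasurable_cst.
by apply: cmeasurable_prod => i; exact: mA.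
Qed.

End Matrices.

(** By Cramer's rule the entries of the inverse are rational functions of the
    entries. *)
Lemma mx_measurable_inv n (A : T -> 'M[R[i]]_n) :
  (forall x, A x \in unitmx) ->
  mx_measurable A -> mx_measurable (fun x => invmx (A x)).
Proof.
move=> uA mA i j.
under eq_fun => x do rewrite /invmx uA mxE /adjugate mxE /cofactor.
apply: cmeasurableM; first exact/cmeasurableV/cmeasurable_det.
apply: cmeasurableM; first exact: cmeasurable_cst.
apply: cmeasurable_det => k l.
by under eq_fun do rewrite !mxE; exact: mA.
Qed.

Lemma mx_measurable_exp n (A : T -> 'M[R[i]]_n.+1) k :
  mx_measurable A -> mx_measurable (fun x => A x ^+ k).
Proof.
move=> mA; elim: k => [|k IH].
  by move=> i j; under eq_fun do rewrite expr0; exact: cmeasurable_cst.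
by under eq_fun do rewrite exprS; exact: mx_measurableM.
Qed.

Lemma cmeasurable_trace n (A : T -> 'M[R[i]]_n) :
  mx_measurable A -> cmeasurable (fun x => \tr (A x)).
Proof. by move=> mA; apply: cmeasurable_sum => i; exact: mA. Qed.

End ComplexMeasurable.

Section TrigIntegral.
Context {disp : measure_display} {T : measurableType disp} {R : realType}.
Variable mu : probability T R.

Lemma integrable_bounded (f : T -> R) (c : R) : measurable_fun setT f ->
  (forall x, `|f x| <= c) -> mu.-integrable setT (fun x => (f x)%:E).
Proof.
move=> mf fc; apply: measurable_bounded_integrable => //.
  by rewrite -ge0_fin_numE //; exact: fin_num_measure.
exists c; split; first exact: num_real.
by move=> y cy x _; apply: le_trans (fc x) (ltW cy).
Qed.

Definition cexp (t : R) : R[i] := cos t +i* sin t.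

Lemma Re_mul_cexp (q : R[i]) t :
  complex.Re (q * cexp t) = complex.Re q * cos t - complex.Im q * sin t.
Proof. by rewrite cReM. Qed.

Lemma measurable_cos_comp (h : T -> R) :
  measurable_fun setT h -> measurable_fun setT (fun x => cos (h x)).
Proof.
move=> mh; have mcos : measurable_fun setT (@cos R).
  by apply: continuous_measurable_fun; exact: continuous_cos.
exact: (measurableT_comp mcos).
Qed.

Lemma measurable_sin_comp (h : T -> R) :
  measurable_fun setT h -> measurable_fun setT (fun x => sin (h x)).
Proof.
move=> mh; have msin : measurable_fun setT (@sin R).
  by apply: continuous_measurable_fun; exact: continuous_sin.
exact: (measurableT_comp msin).
Qed.

Lemma integral_cos_cancelling (h : T -> R) (a : R) : measurable_fun setT h ->
  cancelling mu h -> (\int[mu]_x (cos (a + h x))%:E = 0)%E.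
Proof.
move=> mh /(_ a); under eq_integral do rewrite EFinD.
have mah : measurable_fun setT (fun x => a + h x) by exact: measurable_funD.
have icos : mu.-integrable setT (fun x => (cos (a + h x))%:E).
  apply: (@integrable_bounded _ 1); first exact: measurable_cos_comp.
  by move=> x; exact: cos_max.
rewrite integralD //; last first.
  by apply: (@integrable_bounded _ 1) => // x; rewrite normr1.
rewrite integral_cst // mul1e [X in (X + _)%E](_ : _ = 1%E); last exact: probability_setT.
have fin_cos := integrable_fin_num measurableT icos.
by rewrite -(fineK fin_cos) -EFinD => -[e]; congr EFin; rewrite -[LHS](addKr 1) e addNr.
Qed.

(** Integration of a trigonometric polynomial: of all its terms, only those with
    zero phase, singled out by [b], survive. *)
Lemma integral_trig (I : finType) (q : I -> R[i]) (h : I -> T -> R)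
    (b : pred I) (c0 : R) :
  (forall i, measurable_fun setT (h i)) ->
  (forall i, b i -> forall x, h i x = 0) ->
  (forall i, ~~ b i -> cancelling mu (h i)) ->
  (\int[mu]_x (c0 + \sum_i complex.Re (q i * cexp (h i x)))%:E
   = (c0 + \sum_(i | b i) complex.Re (q i))%:E)%E.
Proof.
move=> mh h0 hc.
have ic i : mu.-integrable setT (fun x => (complex.Re (q i * cexp (h i x)))%:E).
  apply: (@integrable_bounded _ (`|complex.Re (q i)| + `|complex.Im (q i)|)).
    under eq_fun do rewrite Re_mul_cexp.
    apply: measurable_funB; apply: measurable_funM => //.
      exact: measurable_cos_comp.
    exact: measurable_sin_comp.
  move=> x; rewrite Re_mul_cexp; apply: le_trans (ler_normB _ _) _.
  rewrite !normrM; apply: lerD; rewrite -[X in _ <= X]mulr1 ler_wpM2l //.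
    exact: cos_max.
  exact: sin_max.
under eq_integral do rewrite EFinD -sumEFin.
rewrite integralD //; last 2 first.
- by apply: (@integrable_bounded _ `|c0|).
- exact: integrable_sum.
rewrite integral_sum // integral_cst // [X in (_ * X + _)%E](_ : _ = 1%E);
  last exact: probability_setT.
rewrite mule1 EFinD -sumEFin; congr (_ + _)%E.
rewrite [RHS]big_mkcond /=; apply: eq_bigr => i _; case: ifPn => bi.
  under eq_integral => x _ do rewrite Re_mul_cexp h0 // cos0 sin0 mulr1 mulr0 subr0.
  rewrite integral_cst // [X in (_ * X)%E](_ : _ = 1%E) ?mule1 //.
  exact: probability_setT.
under eq_integral do rewrite Re_mul_cexp EFinB !EFinM.
have icos : mu.-integrable setT (fun x => (cos (h i x))%:E).
  apply: (@integrable_bounded _ 1); first exact: measurable_cos_comp.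
  by move=> x; exact: cos_max.
have isin : mu.-integrable setT (fun x => (sin (h i x))%:E).
  apply: (@integrable_bounded _ 1); first exact: measurable_sin_comp.
  by move=> x; exact: sin_max.
rewrite integralB //; last 2 first.
- exact: integrableZl.
- exact: integrableZl.
rewrite !integralZl //.
have -> : (\int[mu]_x (cos (h i x))%:E = 0)%E.
  rewrite -(integral_cos_cancelling 0 (mh i) (hc i bi)).
  by apply: eq_integral => x _; rewrite add0r.
have -> : (\int[mu]_x (sin (h i x))%:E = 0)%E.
  rewrite -(integral_cos_cancelling (- (pi / 2)) (mh i) (hc i bi)).
  by apply: eq_integral => x _; rewrite addrC cosBpihalf.
by rewrite !mule0 sube0.
Qed.

End TrigIntegral.

Section RealLemmas.
Context {R : realType}.

Lemma expR_le_inv (x : R) : x < 1 -> expR x <= (1 - x)^-1.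
Proof.
move=> x1; rewrite -[x in expR x]opprK expRN lef_pV2 ?posrE ?expR_gt0 ?subr_gt0 //.
exact: expR_ge1Dx.
Qed.

(** From [exp x <= 1 / (1 - x)], itself [1 - x <= exp (- x)]. *)
Lemma expR_le_quad (x : R) : `|x| <= 2^-1 -> expR x <= 1 + x + 2 * x ^+ 2.
Proof.
move=> /ler_normlP[x1 x2]; apply: (le_trans (expR_le_inv _)); first lra.
rewrite -[(1 - x)^-1]mul1r ler_pdivrMr; last lra.
have : 0 <= x ^+ 2 * (1 - 2 * x) by rewrite mulr_ge0 ?sqr_ge0 //; lra.
move=> h; rewrite -subr_ge0; apply: (le_trans h).
by rewrite le_eqVlt; apply/orP; left; apply/eqP; ring.
Qed.

Definition sqmod (z : R[i]) : R := complex.Re z ^+ 2 + complex.Im z ^+ 2.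

Lemma normc_sqr (z : R[i]) : Normc.normc z ^+ 2 = sqmod z.
Proof. by case: z => a b; rewrite /sqmod /= sqr_sqrtr // addr_ge0 ?sqr_ge0. Qed.

Lemma normc_nonneg (z : R[i]) : 0 <= Normc.normc z.
Proof. by case: z => a b; exact: sqrtr_ge0. Qed.

Lemma abs_Re_le (z : R[i]) : `|complex.Re z| <= Normc.normc z.
Proof.
case: z => a b /=; rewrite -sqrtr_sqr ler_sqrt ?addr_ge0 ?sqr_ge0 //.
by rewrite lerDl sqr_ge0.
Qed.

Lemma normc_cexp (t : R) : Normc.normc (cexp t) = 1.
Proof. by rewrite /= cos2Dsin2 sqrtr1. Qed.

Lemma normc_sum (I : Type) (s : seq I) (F : I -> R[i]) :
  Normc.normc (\sum_(i <- s) F i) <= \sum_(i <- s) Normc.normc (F i).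
Proof.
elim: s => [|i s IH]; first by rewrite !big_nil Normc.normc0.
by rewrite !big_cons; apply: le_trans (le_normcD _ _) _; rewrite lerD2l.
Qed.

Lemma mul_conj_sqmod (z : R[i]) : z * z^*%R = (sqmod z)%:C.
Proof.
case: z => a b; apply/eqP; rewrite eq_complex /sqmod /=.
by apply/andP; split; apply/eqP; ring.
Qed.

End RealLemmas.

(** * Lower bound on the random Gram matrix *)

Lemma qform_outer (R : realType) n (v u : 'rV[R[i]]_n.+1) :
  qform (outer v) u = (sqmod (\sum_i v 0 i * (u 0 i)^*%R))%:C.
Proof.
rewrite -mul_conj_sqmod /qform /outer !mulmxA -(mulmxA (u *m _)).
have -> : u *m v^t* = (v *m u^t*)^t* by rewrite trCmx_mul trmxCK.
have e : (v *m u^t*) 0 0 = \sum_i v 0 i * (u 0 i)^*%R.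
  by rewrite mxE; apply: eq_bigr => i _; rewrite !mxE.
by rewrite mxE big_ord1 [((_)^t*) _ _]mxE [(_^T) _ _]mxE e mulrC.
Qed.

Lemma sqnorm_sqmod (R : realType) n (u : 'rV[R[i]]_n.+1) :
  sqnorm u = (\sum_i sqmod (u 0 i))%:C.
Proof.
rewrite sqnormE rmorph_sum; apply: eq_bigr => i _.
by rewrite -add_Re2_Im2.
Qed.

Section GramPotential.
Context {disp : measure_display} {T : measurableType disp} {R : realType}.
Variables (n : nat) (theta : 'I_n.+1 -> T -> R).
Hypothesis measurable_theta : forall i, measurable_fun setT (theta i).

Definition exp_row (x : T) : 'rV[R[i]]_n.+1 := \row_i cexp (theta i x).

Lemma cRe_sum (I : Type) (s : seq I) (P : pred I) (F : I -> R[i]) :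
  complex.Re (\sum_(i <- s | P i) F i) = \sum_(i <- s | P i) complex.Re (F i).
Proof. by apply: (big_morph (@complex.Re R) (@cReD R)). Qed.

Lemma norm_cexp (t : R) : `|cexp t| = 1.
Proof. by rewrite normc_def /= cos2Dsin2 sqrtr1. Qed.

Lemma cexp_mul_conj (s t : R) : cexp s * (cexp t)^* = cexp (s - t).
Proof.
rewrite /cexp cosB sinB; apply/eqP; rewrite eq_complex /=; apply/andP; split.
  by apply/eqP; ring.
by apply/eqP; ring.
Qed.

Lemma sqnorm_exp_row x : sqnorm (exp_row x) = n.+1%:R.
Proof.
rewrite sqnormE (eq_bigr (fun=> 1)); last by move=> i _; rewrite mxE norm_cexp expr1n.
by rewrite sumr_const card_ord.
Qed.

(** Any number strictly between 1/2 and 1 would do, with other constants: above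
    1/2, for the final potential to detect a quadratic form below [N / 2]; below
    1, the mean gain of a sample, for the potential not to increase. *)
Definition drift : R := 3 / 4.

Definition gram_step (x : T) (B : 'M[R[i]]_n.+1) :=
  B + (- drift%:C)%:M + outer (exp_row x).

(** Constant in the number [m] of samples to come: the drift carries the time
    dependence. *)
Definition gram_potential (p : nat) (m : nat) (B : 'M[R[i]]_n.+1) : R :=
  complex.Re (\tr (invmx B ^+ p)).

(** A step subtracts at most [drift] from the smallest eigenvalue, so this lower
    bound keeps the matrix above [L] until the samples are exhausted. *)
Definition gram_inv (L : R) (m : nat) (B : 'M[R[i]]_n.+1) :=
  selfadjoint B /\ mx_ge B (L + drift * m%:R)%:C.

Lemma gram_runE B m (v : m.-tuple T) :
  run gram_step B v
    = B + \sum_(i < m) (outer (exp_row (tnth v i)) + (- drift%:C)%:M).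
Proof.
elim: m B v => [|m IH] B v; first by rewrite tuple0 big_ord0 addr0.
case/tupleP: v => x v; rewrite /run /= -/(run gram_step (gram_step x B) v) IH.
rewrite big_ord_recl tnth0 /gram_step !addrA; congr (_ + _).
  by rewrite addrAC.
by apply: eq_bigr => i _; rewrite tnthS.
Qed.

Lemma cmeasurable_cexp d' (T' : measurableType d') (h : T' -> R) :
  measurable_fun setT h -> cmeasurable (fun x => cexp (h x)).
Proof.
by move=> mh; split; [exact: measurable_cos_comp|exact: measurable_sin_comp].
Qed.

Lemma mx_measurable_outer d' (T' : measurableType d') (g : T' -> T) :
  measurable_fun setT g -> mx_measurable (fun x => outer (exp_row (g x))).
Proof.
move=> mg i j; have mi k : cmeasurable (fun x => cexp (theta k (g x))).
  by apply: cmeasurable_cexp; exact: measurableT_comp.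
have -> : (fun x => outer (exp_row (g x)) i j)
    = (fun x => (cexp (theta i (g x)))^* * cexp (theta j (g x))).
  by apply/funext => x; rewrite mxE big_ord1 !mxE.
by apply: cmeasurableM => //; exact: cmeasurable_conj.
Qed.

Section Step.
Variables (L : R) (k : nat).
Hypotheses (L0 : 0 < L) (Lp : (2 ^ k)%:R * n.+1%:R <= (1 - drift) * L).
Local Notation p := (2 ^ k)%N.

Let inv_pos m B : gram_inv L m B -> selfadjoint B /\ mx_ge B L%:C.
Proof.
move=> [hB Bge]; split=> // u; apply: le_trans (Bge u).
rewrite ler_wpM2r ?sqnorm_ge0 // lecR lerDl mulr_ge0 // /drift; lra.
Qed.

Let LC0 : 0 < L%:C :> R[i]. Proof. by rewrite ltcR. Qed.

Lemma gram_potential_ge0 m B : gram_inv L m B -> 0 <= gram_potential p m B.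
Proof.
move=> /inv_pos [hB BL].
by have := mxtrace_resolvent_ge0 p hB BL LC0; rewrite lecE => /andP[].
Qed.

Lemma gram_inv_shift m B : gram_inv L m.+1 B ->
  gram_inv L m (B + (- drift%:C)%:M).
Proof.
move=> [hB Bge]; split.
  by apply: selfadjointD => //; apply: selfadjoint_scalar; rewrite realN complex_real.
have -> : (L + drift * m%:R)%:C = (L + drift * m.+1%:R)%:C + - drift%:C :> R[i].
  by rewrite -rmorphN -rmorphD /=; congr (_ %:C); rewrite -natr1; ring.
exact: mx_geD (mx_ge_scalar _).
Qed.

Lemma gram_inv_outer m B x : gram_inv L m B -> gram_inv L m (B + outer (exp_row x)).
Proof.
move=> [hB Bge]; split; first by apply: selfadjointD => //; exact: trC_outer.
move=> u; apply: le_trans (Bge u) _.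
by rewrite /qform mulmxDr mulmxDl [in X in _ <= X]mxE lerDl outer_ge0.
Qed.

Lemma gram_inv_step m B x : gram_inv L m.+1 B -> gram_inv L m (gram_step x B).
Proof. by move=> /gram_inv_shift; exact: gram_inv_outer. Qed.

Lemma gram_inv_run m B (v : m.-tuple T) : gram_inv L m B ->
  gram_inv L 0 (run gram_step B v).
Proof.
elim: m B v => [|m IH] B v; first by rewrite tuple0.
by case/tupleP: v => x v IB; apply: IH; exact: gram_inv_step.
Qed.

Lemma measurable_gram_step m B : gram_inv L m.+1 B ->
  measurable_fun setT (fun x => gram_potential p m (gram_step x B)).
Proof.
move=> IB; suff /cmeasurable_trace[] :
  mx_measurable (fun x => invmx (gram_step x B) ^+ p) by [].
apply: mx_measurable_exp; apply: mx_measurable_inv => [x|i j].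
  by have [hB BL] := inv_pos (gram_inv_step x IB); exact: mx_ge_unit LC0.
under eq_fun do rewrite mxE.
apply: cmeasurableD; first exact: cmeasurable_cst.
exact: (mx_measurable_outer (@measurable_id _ _ _)).
Qed.

Lemma measurable_gram_run m B : gram_inv L m B ->
  measurable_fun [set: m.-tuple T]
    (fun v : m.-tuple T => gram_potential p 0 (run gram_step B v)).
Proof.
move=> IB; suff /cmeasurable_trace[] : mx_measurable
    (fun v : m.-tuple T => invmx (run gram_step B v) ^+ p) by [].
apply: mx_measurable_exp; apply: mx_measurable_inv => [v|i j].
  by have [hB BL] := inv_pos (gram_inv_run v IB); exact: mx_ge_unit LC0.
under eq_fun do rewrite gram_runE mxE summxE.
apply: cmeasurableD; first exact: cmeasurable_cst.
apply: cmeasurable_sum => l.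
under eq_fun do rewrite mxE.
apply: cmeasurableD; last exact: cmeasurable_cst.
exact: (mx_measurable_outer (measurable_tnth l)).
Qed.

(** Both error terms are linear in a matrix power [Q]: the gain from the rank
    one update is [qform Q] of the random row, whose mean is [\tr Q] by
    orthogonality of the characters, and this compensates exactly the loss from
    the shift. *)
Lemma gram_potential_step (mu : probability T R) m B :
  (forall i j, i != j -> cancelling mu (fun x => theta i x - theta j x)) ->
  gram_inv L m.+1 B ->
  (\int[mu]_x (gram_potential p m (gram_step x B))%:E
     <= (gram_potential p m.+1 B)%:E)%E.
Proof.
move=> mu_c IB; have [hB' BL'] := inv_pos (gram_inv_shift IB).
set B' := B + (- drift%:C)%:M in hB' BL' *.
have drift0 : 0 <= drift%:C :> R[i] by rewrite lecR /drift; lra.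
have pM : (2 ^ k)%:R * n.+1%:R <= (1 - drift%:C) * L%:C :> R[i].
  have -> : (2 ^ k)%:R * n.+1%:R = ((2 ^ k)%:R * n.+1%:R)%:C :> R[i].
    by rewrite rmorphM !rmorph_nat.
  have -> : (1 - drift%:C) * L%:C = ((1 - drift) * L)%:C :> R[i].
    by apply/eqP; rewrite eq_complex /=; apply/andP; split; apply/eqP; ring.
  by rewrite lecR.
have rank_one x := resolvent_rank_one_update hB' BL' LC0 drift0
  (eq_ind_r (fun z => z <= _) (lexx _) (sqnorm_exp_row x)) pM.
pose Q := invmx B' ^+ p.+1.
pose c1 := drift * p%:R.
have c1E : c1%:C = drift%:C * p%:R :> R[i] by rewrite [LHS]rmorphM /= rmorph_nat.
pose q (ij : 'I_n.+1 * 'I_n.+1) : R[i] := - (c1%:C * Q ij.1 ij.2).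
pose h (ij : 'I_n.+1 * 'I_n.+1) x := theta ij.1 x - theta ij.2 x.
have potE x : gram_potential p m (gram_step x B) <=
    complex.Re (\tr (invmx B' ^+ p)) + \sum_ij complex.Re (q ij * cexp (h ij x)).
  have := rank_one x; rewrite lecE => /andP[_]; rewrite -/(gram_step x B) => /le_trans; apply.
  rewrite cReD lerD2l -cRe_sum le_eqVlt; apply/orP; left; apply/eqP; congr complex.Re.
  rewrite -/Q qformE -mulNr mulr_sumr.
  under eq_bigr do rewrite mulr_sumr.
  rewrite pair_big /=; apply: eq_bigr => -[i j] _ /=.
  rewrite /q /h /= -cexp_mul_conj !mxE c1E.
  ring.
apply: (@le_trans _ _ (\int[mu]_x (complex.Re (\tr (invmx B' ^+ p))
    + \sum_ij complex.Re (q ij * cexp (h ij x)))%:E)%E).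
  apply: ge0_le_integral => //.
  - by move=> x _; rewrite lee_fin; apply: gram_potential_ge0 (gram_inv_step x IB).
  - by apply/measurable_EFinP; exact: measurable_gram_step.
  - apply/measurable_EFinP; apply: measurable_funD => //.
    apply: measurable_sum => ij.
    have [] // : cmeasurable (fun x => q ij * cexp (h ij x)).
    apply: cmeasurableM; first exact: cmeasurable_cst.
    by apply: cmeasurable_cexp; exact: measurable_funB.
  - by move=> x _; rewrite lee_fin; exact: potE.
rewrite (@integral_trig _ _ _ _ _ _ _ (fun ij => ij.1 == ij.2)); last 3 first.
- by move=> ij; exact: measurable_funB.
- by move=> [i j] /= /eqP -> x; rewrite /h subrr.
- by move=> [i j] /= ij; exact: mu_c.
rewrite lee_fin.
have := mxtrace_resolvent_shift p hB' BL' LC0 drift0.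
have -> : B' + drift%:C%:M = B.
  by rewrite /B' -addrA -raddfD /= addNr raddf0 addr0.
rewrite lecE => /andP[_]; apply: le_trans.
rewrite cReD lerD2l -cRe_sum le_eqVlt; apply/orP; left; apply/eqP; congr complex.Re.
rewrite -/Q -mulNr /mxtrace mulr_sumr.
rewrite (eq_bigl (fun ij => true && (ij.2 == ij.1))); last first.
  by move=> ij; rewrite eq_sym.
rewrite -(pair_big_dep xpredT (fun i j => j == i) (fun i j => q (i, j))) /=.
apply: eq_bigr => i _; rewrite big_pred1_eq /q c1E.
by rewrite mulNr.
Qed.

End Step.
End GramPotential.

Section GramBound.
Context {disp disp' : measure_display} {T : measurableType disp} {R : realType}.
Context {Omega : measurableType disp'} (P : probability Omega R).
Variables (n : nat) (theta : 'I_n.+1 -> T -> R).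
Hypothesis measurable_theta : forall i, measurable_fun setT (theta i).
Variables (N : nat) (X : 'I_N -> {RV P >-> T}).
Hypothesis N0 : (0 < N)%N.
Hypothesis indX : mutually_independent X.
Hypothesis X_cancel : forall l i j, i != j ->
  cancelling (distribution P (X l)) (fun x => theta i x - theta j x).

(** The potential starts from [2 N] times the identity, so that the accumulated
    drift [(3/4) N] leaves the matrix above [N] at all times. A final potential
    below [((7/4) N)^-p] puts the final matrix above [(7/4) N], hence the Gram
    matrix above [(7/4) N - (2 N - (3/4) N) = N / 2]. *)
Lemma gram_lower_bound (eps : R) k :
  (2 ^ k)%:R * n.+1%:R <= N%:R / 4 :> R ->
  n.+1%:R * (7 / 8) ^+ (2 ^ k) < eps ->
  prob_exceeds P (1 - eps) (fun w => forall u : 'rV[R[i]]_n.+1,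
    (N%:R / 2)%:C * sqnorm u
      <= \sum_(l < N) qform (outer (exp_row theta (X l w))) u).
Proof.
move=> kN keps; set p := (2 ^ k)%N in kN keps.
have NR0 : 0 < N%:R :> R by rewrite ltr0n.
have pN : (2 ^ k)%:R * n.+1%:R <= (1 - @drift R) * N%:R by rewrite /drift; lra.
pose B0 : 'M[R[i]]_n.+1 := (2 * N%:R)%:C%:M.
have B0_inv : gram_inv N%:R N B0.
  split; first by apply: selfadjoint_scalar; rewrite complex_real.
  move=> u; apply: le_trans (mx_ge_scalar _ u).
  by rewrite ler_wpM2r ?sqnorm_ge0 // lecR /drift; lra.
pose Y w := gram_potential p 0 (run (gram_step theta) B0 (joint X w)).
have mY : measurable_fun setT Y.
  have mrun := measurable_gram_run measurable_theta k NR0 B0_inv.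
  exact: (measurableT_comp mrun (measurable_joint X)).
have run_inv w := gram_inv_run theta (joint X w) B0_inv.
have Y0 w : 0 <= Y w by exact: (gram_potential_ge0 k NR0 (run_inv w)).
pose s : R := 7 / 4 * N%:R.
have s0 : 0 < s by rewrite /s mulr_gt0.
have Yb : (\int[P]_w (Y w)%:E <= (n.+1%:R * (2 * N%:R)^-1 ^+ p)%:E)%E.
  have -> : (\int[P]_w (Y w)%:E = \int[tuple_prob (fun i => distribution P (X i))]_v
      (gram_potential p 0 (run (gram_step theta) B0 (v : N.-tuple T)))%:E)%E.
    have mrun := measurable_gram_run measurable_theta k NR0 B0_inv.
    pose f (v : N.-tuple T) := (gram_potential p 0 (run (gram_step theta) B0 v))%:E.
    rewrite -(ge0_integral_joint (f := f) indX) //.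
      by apply/measurable_EFinP.
    move=> v; rewrite lee_fin.
    exact: (gram_potential_ge0 k NR0 (gram_inv_run theta v B0_inv)).
  have -> : n.+1%:R * (2 * N%:R)^-1 ^+ p = gram_potential p N B0.
    rewrite /gram_potential /B0 invmx_scalar -fmorphV scalar_mxX mxtrace_scalar.
    by rewrite -rmorphXn -rmorphMn /= mulr_natl.
  apply: (potential_le (Inv := gram_inv N%:R)) B0_inv.
  - exact: (gram_potential_ge0 k NR0).
  - by move=> m B x; exact: gram_inv_step.
  - move=> m B; exact: (measurable_gram_step measurable_theta k NR0).
  - move=> m B; exact: (measurable_gram_run measurable_theta k NR0).
  - move=> l m B; apply: gram_potential_step => //; exact: X_cancel.
have thr0 : 0 < s^-1 ^+ p by rewrite exprn_gt0 // invr_gt0.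
have b_lt : n.+1%:R * (2 * N%:R)^-1 ^+ p < eps * s^-1 ^+ p.
  have -> : (2 * N%:R)^-1 = 7 / 8 * s^-1 by rewrite /s; field; rewrite gt_eqF.
  by rewrite exprMn mulrA ltr_pM2r.
apply: prob_exceedsW (prob_exceeds_of_integral mY Y0 Yb thr0 b_lt) => w Yw u.
have [hB Bge] := run_inv w.
have Bge0 : mx_ge (run (gram_step theta) B0 (joint X w)) N%:R%:C.
  by move: Bge; rewrite mulr0 addr0.
have N0C : 0 < N%:R%:C :> R[i] by rewrite ltcR.
have tr0 := mxtrace_resolvent_ge0 p hB Bge0 N0C.
have s0C : 0 < s%:C :> R[i] by rewrite ltcR.
have p0 : (0 < p)%N by rewrite expn_gt0.
have tr_lt : \tr (invmx (run (gram_step theta) B0 (joint X w)) ^+ p) < s%:C^-1 ^+ p.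
  have -> : s%:C^-1 ^+ p = (s^-1 ^+ p)%:C :> R[i] by rewrite rmorphXn /= fmorphV.
  by rewrite ltcE /= eq_sym; move: tr0 Yw; rewrite lecE /= => /andP[-> _].
have /(_ u) := mxtrace_resolvent_gt hB Bge0 N0C s0C p0 tr_lt.
have -> : run (gram_step theta) B0 (joint X w) =
    (2 * N%:R - drift * N%:R)%:C%:M + \sum_(l < N) outer (exp_row theta (X l w)).
  rewrite gram_runE big_split /= sumr_const card_ord addrCA addrC; congr (_ + _).
    apply/matrixP => i j; rewrite mxE mulmxnE !mxE.
    case: eqP => _; rewrite ?mulr1n ?mulr0n ?mul0rn ?addr0 //.
    by rewrite -rmorphN -rmorphMn -rmorphD /= mulNrn -[drift *+ N]mulr_natr.
  by apply: eq_bigr => l _; rewrite tnth_mktuple.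
rewrite /qform mulmxDr mulmxDl mxE -/(qform _ u) /qform.
rewrite mul_mx_scalar -scalemxAl [X in _ <= X + _]mxE -/(sqnorm u).
rewrite -lerBlDl -mulrBl -rmorphB /=.
have -> : s - (2 * N%:R - drift * N%:R) = N%:R / 2 :> R by rewrite /s /drift; field.
move=> /le_trans; apply; rewrite mulmx_sumr mulmx_suml summxE.
exact: lexx.
Qed.
End GramBound.

(** * Uniform deviation of the correlations *)

Section Bernstein.
Context {disp : measure_display} {T : measurableType disp} {R : realType}.
Variables (K : finType) (theta : K -> T -> R).
Hypothesis measurable_theta : forall k, measurable_fun setT (theta k).
Variables (k : K) (q : K -> R[i]) (W lambda : R).
Hypotheses (qk : q k = 0) (qW : \sum_j Normc.normc (q j) <= W).
Hypotheses (lambda0 : 0 <= lambda) (lambdaW : lambda * W <= 2^-1).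

(** With [q] equal to the coefficients off [k], this is the contribution of one
    sample point to the correlation with the frequency [k], diagonal term
    excluded. *)
Definition trig_sum (x : T) : R[i] := \sum_j q j * cexp (theta j x - theta k x).
Definition variance_proxy : R := \sum_j sqmod (q j).

Lemma normc_trig_sum x : Normc.normc (trig_sum x) <= W.
Proof.
apply: le_trans (normc_sum _ _) _; apply: le_trans qW.
by apply: ler_sum => j _; rewrite Normc.normcM normc_cexp mulr1.
Qed.

Lemma sqmod_trig_sum x : sqmod (trig_sum x) =
  \sum_(ij : K * K) complex.Re (q ij.1 * (q ij.2)^*%R * cexp (theta ij.1 x - theta ij.2 x)).
Proof.
transitivity (complex.Re (trig_sum x * (trig_sum x)^*%R)).
  by rewrite mul_conj_sqmod.
rewrite /trig_sum rmorph_sum /= mulr_suml.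
under [X in complex.Re X = _]eq_bigr do rewrite mulr_sumr.
rewrite pair_big /= cRe_sum; apply: eq_bigr => -[i j] _ /=; congr complex.Re.
have -> : theta i x - theta j x = (theta i x - theta k x) - (theta j x - theta k x) by ring.
by rewrite -(cexp_mul_conj (theta i x - theta k x)) rmorphM /=; ring.
Qed.

(** The square of the real part is bounded by the square of the modulus because
    the latter is a trigonometric polynomial in the differences of the phases,
    which [integral_trig] integrates exactly. *)
Lemma expR_trig_sum_le x : expR (lambda * complex.Re (trig_sum x)) <=
  1 + (\sum_j complex.Re (lambda%:C * q j * cexp (theta j x - theta k x))
  + \sum_(ij : K * K) complex.Re ((2 * lambda ^+ 2)%:C * (q ij.1 * (q ij.2)^*%R)
       * cexp (theta ij.1 x - theta ij.2 x))).
Proof.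
set z := complex.Re (trig_sum x).
have zW : `|z| <= W by apply: le_trans (abs_Re_le _) (normc_trig_sum x).
apply: le_trans (expR_le_quad _) _.
  by rewrite normrM ger0_norm //; apply: le_trans lambdaW; rewrite ler_wpM2l.
have ReZ (a : R) (y : R[i]) : complex.Re (a%:C * y) = a * complex.Re y.
  by rewrite cReM /= mul0r subr0.
rewrite -addrA lerD2l; apply: lerD.
  rewrite /z /trig_sum cRe_sum mulr_sumr le_eqVlt; apply/orP; left; apply/eqP.
  by apply: eq_bigr => j _; rewrite -mulrA ReZ.
under [X in _ <= X]eq_bigr do rewrite -mulrA ReZ.
rewrite -mulr_sumr -sqmod_trig_sum exprMn mulrA ler_wpM2l //.
  by rewrite mulr_ge0 // sqr_ge0.
by rewrite /sqmod lerDl sqr_ge0.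
Qed.

Lemma measurable_trig_sum : cmeasurable trig_sum.
Proof.
apply: cmeasurable_sum => j; apply: cmeasurableM; first exact: cmeasurable_cst.
by apply: cmeasurable_cexp; exact: measurable_funB.
Qed.

(** The moment generating function of the sum accumulated so far, times the
    largest factor that the [m] samples to come can contribute. *)
Definition bernstein_potential (m : nat) (s : R) : R :=
  expR (lambda * s + m%:R * (2 * lambda ^+ 2 * variance_proxy)).
Definition bernstein_step (x : T) (s : R) : R := s + complex.Re (trig_sum x).

Lemma measurable_bernstein m d' (T' : measurableType d') (f : T' -> R) :
  measurable_fun setT f -> measurable_fun setT (fun x => bernstein_potential m (f x)).
Proof.
move=> mf; apply: (measurableT_comp (@measurable_expR R)).
by apply: measurable_funD => //; exact: measurable_funM.
Qed.

Lemma bernstein_potential_step (mu : probability T R) m s :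
  (forall i j, i != j -> cancelling mu (fun x => theta i x - theta j x)) ->
  (\int[mu]_x (bernstein_potential m (bernstein_step x s))%:E
     <= (bernstein_potential m.+1 s)%:E)%E.
Proof.
move=> mu_c; set E0 := bernstein_potential m s.
have E00 : 0 <= E0 by exact: expR_ge0.
(* The majorant of the exponential is one trigonometric polynomial: a linear
   part with phases relative to [k], and a quadratic part with phases between
   all pairs. *)
pose Q (u : K + K * K) : R[i] := E0%:C * match u with
  | inl j => lambda%:C * q j
  | inr ij => (2 * lambda ^+ 2)%:C * (q ij.1 * (q ij.2)^*%R) end.
pose h (u : K + K * K) x := match u with
  | inl j => theta j x - theta k x
  | inr ij => theta ij.1 x - theta ij.2 x end.
pose b (u : K + K * K) := match u with inl j => j == k | inr ij => ij.1 == ij.2 end.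
have ReZ (a : R) (y : R[i]) : complex.Re (a%:C * y) = a * complex.Re y.
  by rewrite cReM /= mul0r subr0.
have mh u : measurable_fun setT (h u) by case: u => [j|[i j]]; exact: measurable_funB.
have mz : measurable_fun setT (bernstein_step^~ s).
  by apply: measurable_funD => //; exact: measurable_trig_sum.1.
apply: (@le_trans _ _ (\int[mu]_x (E0 + \sum_u complex.Re (Q u * cexp (h u x)))%:E)%E).
  apply: ge0_le_integral => //.
  - by move=> x _; rewrite lee_fin expR_ge0.
  - by apply/measurable_EFinP; exact: measurable_bernstein.
  - apply/measurable_EFinP; apply: measurable_funD => //.
    apply: measurable_sum => u.
    have [] // : cmeasurable (fun x => Q u * cexp (h u x)).
    by apply: cmeasurableM; [exact: cmeasurable_cst|exact: cmeasurable_cexp].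
  - move=> x _; rewrite lee_fin.
    have -> : bernstein_potential m (bernstein_step x s) =
        E0 * expR (lambda * complex.Re (trig_sum x)).
      by rewrite /E0 /bernstein_potential -expRD; congr expR; rewrite /bernstein_step; ring.
    apply: le_trans (ler_wpM2l E00 (expR_trig_sum_le x)) _.
    rewrite mulrDr mulr1 lerD2l big_sumType /= mulrDr !mulr_sumr.
    by apply: lerD; rewrite le_eqVlt; apply/orP; left; apply/eqP; apply: eq_bigr => j _;
      rewrite /Q /h -(mulrA E0%:C) ReZ.
rewrite (@integral_trig _ _ _ _ _ _ _ b) //; last 2 first.
- by move=> [j|[i j]] /= /eqP -> x; rewrite subrr.
- by move=> [j|[i j]] /= ij; exact: mu_c.
rewrite lee_fin big_sumType /=.
have Qk : Q (inl k) = 0 by rewrite /Q qk !mulr0.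
rewrite big_pred1_eq Qk [complex.Re 0]/= add0r.
have -> : \sum_(i | i.1 == i.2) complex.Re (Q (inr i)) =
    E0 * (2 * lambda ^+ 2 * variance_proxy).
  rewrite (eq_bigl (fun ij => true && (ij.2 == ij.1))); last first.
    by move=> ij; rewrite eq_sym.
  rewrite -(pair_big_dep xpredT (fun i j => j == i)
    (fun i j => complex.Re (Q (inr (i, j))))) /=.
  rewrite /variance_proxy !mulr_sumr; apply: eq_bigr => i _.
  by rewrite big_pred1_eq /Q ReZ /= ReZ mul_conj_sqmod.
have -> : bernstein_potential m.+1 s = E0 * expR (2 * lambda ^+ 2 * variance_proxy).
  by rewrite /E0 /bernstein_potential -expRD; congr expR; rewrite -natr1; ring.
by rewrite -{1}[E0]mulr1 -mulrDr ler_wpM2l // expR_ge1Dx.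
Qed.

Lemma bernstein_runE m (v : m.-tuple T) s :
  run bernstein_step s v = s + \sum_(i < m) complex.Re (trig_sum (tnth v i)).
Proof.
elim: m s v => [|m IH] s v; first by rewrite tuple0 big_ord0 addr0.
case/tupleP: v => x v; rewrite /run /= -/(run bernstein_step (bernstein_step x s) v) IH.
rewrite big_ord_recl tnth0 /bernstein_step !addrA; congr (_ + _).
by apply: eq_bigr => i _; rewrite tnthS.
Qed.

Lemma measurable_bernstein_run m s :
  measurable_fun [set: m.-tuple T] (fun v : m.-tuple T => run bernstein_step s v).
Proof.
under eq_fun do rewrite bernstein_runE.
apply: measurable_funD => //; apply: measurable_sum => i.
exact: (measurableT_comp measurable_trig_sum.1 (measurable_tnth i)).
Qed.

Lemma exp_moment_le N (mu : 'I_N -> probability T R) :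
  (forall l i j, i != j -> cancelling (mu l) (fun x => theta i x - theta j x)) ->
  (\int[tuple_prob mu]_v
     (expR (lambda * \sum_(l < N) complex.Re (trig_sum (tnth (v : N.-tuple T) l))))%:E
   <= (expR (N%:R * (2 * lambda ^+ 2 * variance_proxy)))%:E)%E.
Proof.
move=> mu_c.
have := @potential_le _ _ _ _ bernstein_step bernstein_potential (fun _ _ => True)
  _ _ _ _ N mu 0 _ I.
rewrite /bernstein_potential mulr0 add0r.
under eq_integral do rewrite bernstein_runE mul0r addr0 add0r.
apply.
- by move=> *; exact: expR_ge0.
- by [].
- move=> m s _; apply: measurable_bernstein.
  by apply: measurable_funD => //; exact: measurable_trig_sum.1.
- by move=> m s _; apply: measurable_bernstein; exact: measurable_bernstein_run.
- by move=> l m s _; exact: bernstein_potential_step (mu_c l).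
Qed.

End Bernstein.

Section Deviation.
Context {disp disp' : measure_display} {T : measurableType disp} {R : realType}.
Context {Omega : measurableType disp'} (P : probability Omega R).
Variables (K : finType) (theta : K -> T -> R).
Hypothesis measurable_theta : forall k, measurable_fun setT (theta k).
Variables (N : nat) (X : 'I_N -> {RV P >-> T}).
Hypothesis indX : mutually_independent X.
Hypothesis X_cancel : forall l i j, i != j ->
  cancelling (distribution P (X l)) (fun x => theta i x - theta j x).
Variable c : K -> R[i].

Definition off_coef (k j : K) : R[i] := if j == k then 0 else c j.

(** The four directions [1], [-1], ['i], [-'i]: bounding the real parts of their
    products with [z] bounds both coordinates of [z]. *)
Definition direction (r : bool * bool) : R[i] :=
  (if r.1 then 1 else 'i%C) * (if r.2 then 1 else -1).

Definition off_dir_coef (k : K) (r : bool * bool) (j : K) : R[i] :=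
  direction r * off_coef k j.

Lemma normc_direction r : Normc.normc (direction r) = 1.
Proof.
rewrite Normc.normcM; case: r => [[] []] /=;
  by rewrite ?oppr0 ?sqrrN ?expr0n ?expr1n /= ?add0r ?addr0 sqrtr1 mulr1.
Qed.

Lemma sqmod_direction r z : sqmod (direction r * z) = sqmod z.
Proof. by rewrite -!normc_sqr Normc.normcM normc_direction mul1r. Qed.

(** A union bound: the sum, over the frequencies and the four directions, of the
    exponentials of the deviations is below [exp (lambda t)] only if each
    deviation is below [t]. *)
Lemma off_deviation (W S2 lambda t eps : R) :
  \sum_j Normc.normc (c j) <= W -> \sum_j sqmod (c j) <= S2 ->
  0 < lambda -> lambda * W <= 2^-1 ->
  (#|K| * 4)%:R * expR (N%:R * (2 * lambda ^+ 2 * S2)) < eps * expR (lambda * t) ->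
  prob_exceeds P (1 - eps) (fun w => forall k,
    let z := \sum_(l < N) trig_sum theta k (off_coef k) (X l w) in
    `|complex.Re z| < t /\ `|complex.Im z| < t).
Proof.
move=> cW cS l0 lW small.
have offW k r : \sum_j Normc.normc (off_dir_coef k r j) <= W.
  apply: le_trans cW; apply: ler_sum => j _.
  rewrite /off_dir_coef /off_coef Normc.normcM normc_direction mul1r.
  by case: ifP => // _; rewrite Normc.normc0 normc_nonneg.
have offS k r : variance_proxy (off_dir_coef k r) <= S2.
  apply: le_trans cS; apply: ler_sum => j _.
  rewrite /off_dir_coef /off_coef sqmod_direction; case: ifP => // _.
  by rewrite /sqmod /= expr0n /= addr0 addr_ge0 ?sqr_ge0.
have offk k r : off_dir_coef k r k = 0 by rewrite /off_dir_coef /off_coef eqxx mulr0.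
pose G (kr : K * (bool * bool)) (v : N.-tuple T) : R :=
  expR (lambda * \sum_(l < N) complex.Re
    (trig_sum theta kr.1 (off_dir_coef kr.1 kr.2) (tnth v l))).
have mG kr : measurable_fun [set: N.-tuple T] (G kr).
  apply: (measurableT_comp (@measurable_expR R)).
  apply: measurable_funM => //; apply: measurable_sum => l.
  exact: (measurableT_comp (measurable_trig_sum measurable_theta _ _).1 (measurable_tnth l)).
pose Y w := \sum_kr G kr (joint X w).
have mY : measurable_fun setT Y.
  by apply: measurable_sum => kr; exact: (measurableT_comp (mG kr) (measurable_joint X)).
have Y0 w : 0 <= Y w by apply: sumr_ge0 => kr _; exact: expR_ge0.
have Yb : (\int[P]_w (Y w)%:E <=
    ((#|K| * 4)%:R * expR (N%:R * (2 * lambda ^+ 2 * S2)))%:E)%E.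
  have -> : (\int[P]_w (Y w)%:E = \sum_kr \int[P]_w (G kr (joint X w))%:E)%E.
    rewrite -ge0_integral_sum //.
    - by apply: eq_integral => w _; rewrite sumEFin.
    - move=> kr; apply/measurable_EFinP.
      exact: (measurableT_comp (mG kr) (measurable_joint X)).
    - by move=> kr w _; rewrite lee_fin expR_ge0.
  have -> : (#|K| * 4)%:R * expR (N%:R * (2 * lambda ^+ 2 * S2)) =
      \sum_(kr : K * (bool * bool)) expR (N%:R * (2 * lambda ^+ 2 * S2)).
    by rewrite sumr_const card_prod card_prod card_bool mulr_natl.
  rewrite -sumEFin; apply: lee_sum => -[k r] _.
  rewrite (ge0_integral_joint (f := fun v => (G (k, r) v)%:E) indX); last 2 first.
  - exact/measurable_EFinP.
  - by move=> v; rewrite lee_fin expR_ge0.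
  apply: le_trans (exp_moment_le measurable_theta (offk k r) (offW k r) (ltW l0) lW _) _.
    by move=> l i j ij; exact: X_cancel.
  by rewrite lee_fin ler_expR ler_wpM2l // ler_wpM2l // mulr_ge0 // sqr_ge0.
apply: prob_exceedsW (prob_exceeds_of_integral mY Y0 Yb (expR_gt0 _) small) => w Yw k z.
have dirlt r : complex.Re (direction r * z) < t.
  rewrite -(ltr_pM2l l0) -ltr_expR; apply: le_lt_trans Yw.
  rewrite /Y (bigD1 (k, r)) //=; apply: le_trans (_ : G (k, r) (joint X w) <= _); last first.
    by rewrite lerDl; apply: sumr_ge0 => kr _; exact: expR_ge0.
  rewrite /G /= le_eqVlt; apply/orP; left; apply/eqP; congr (expR (_ * _)).
  rewrite /z mulr_sumr cRe_sum; apply: eq_bigr => l _; congr complex.Re.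
  rewrite tnth_mktuple /trig_sum mulr_sumr; apply: eq_bigr => j _.
  by rewrite mulrA.
have := (dirlt (true, true), dirlt (true, false), dirlt (false, true), dirlt (false, false)).
case: (z) => a b; rewrite /direction /= => -[[[h1 h2] h3] h4].
by split; apply/ltr_normlP; split; lra.
Qed.

End Deviation.

(** * Deterministic analysis of the pursuit *)

Section Norms.
Context {R : realType}.

Lemma l2norm_sqr (I : finType) (v : I -> R[i]) : l2norm v ^+ 2 = \sum_i sqmod (v i).
Proof.
rewrite /l2norm sqr_sqrtr; last by apply: sumr_ge0 => i _; exact: sqr_ge0.
by apply: eq_bigr => i _; rewrite normc_sqr.
Qed.

Lemma l2norm_ge0 (I : finType) (v : I -> R[i]) : 0 <= l2norm v.
Proof. exact: sqrtr_ge0. Qed.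

(** Cauchy-Schwarz against the indicator of [A]. *)
Lemma sum_le_sqrt (I : finType) (A : {set I}) (a : I -> R) m :
  (0 < m)%N -> (#|A| <= m)%N -> (forall i, i \notin A -> a i = 0) ->
  \sum_i a i <= Num.sqrt m%:R * Num.sqrt (\sum_i a i ^+ 2).
Proof.
move=> m0 Am a0; set x := \sum_i a i; set S := \sum_i _.
have m0R : 0 < m%:R :> R by rewrite ltr0n.
have xA : x = \sum_(i in A) a i.
  rewrite /x (bigID [pred i | i \in A]) /= [X in _ + X]big1 ?addr0 //.
have SA : S = \sum_(i in A) a i ^+ 2.
  rewrite /S (bigID [pred i | i \in A]) /= [X in _ + X]big1 ?addr0 // => i /a0 ->.
  by rewrite expr0n.
have x2 : x ^+ 2 <= m%:R * S.
  have : 0 <= \sum_(i in A) (m%:R * a i - x) ^+ 2 by apply: sumr_ge0 => i _; exact: sqr_ge0.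
  have -> : \sum_(i in A) (m%:R * a i - x) ^+ 2
      = m%:R ^+ 2 * S - 2 * m%:R * x ^+ 2 + #|A|%:R * x ^+ 2.
    rewrite SA mulr_sumr.
    have -> : 2 * m%:R * x ^+ 2 = \sum_(i in A) 2 * m%:R * x * a i.
      by rewrite -mulr_sumr -xA; ring.
    rewrite [#|A|%:R * _]mulr_natl -sumr_const -sumrB -big_split /=.
    by apply: eq_bigr => i _; ring.
  move=> h; have Am' : #|A|%:R * x ^+ 2 <= m%:R * x ^+ 2.
    by rewrite ler_wpM2r ?sqr_ge0 // ler_nat.
  rewrite -(ler_pM2l m0R); lra.
(* Square roots are taken only now, so that a vanishing sum needs no separate
   case. *)
have S0 : 0 <= S by apply: sumr_ge0 => i _; exact: sqr_ge0.
rewrite -sqrtrM; last exact: ltW.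
apply: (le_trans (ler_norm x)).
by rewrite -sqrtr_sqr ler_sqrt // mulr_ge0 // ltW.
Qed.

Lemma normc_dotc_le N (u v : 'I_N -> R[i]) : (0 < N)%N ->
  (forall l, Normc.normc (v l) = 1) ->
  Normc.normc (dotc u v) <= Num.sqrt N%:R * l2norm u.
Proof.
move=> N0 v1; apply: le_trans (normc_sum _ _) _.
apply: le_trans (sum_le_sqrt (A := [set: 'I_N]%SET) N0 _ _).
- apply: ler_sum => l _; rewrite Normc.normcM.
  have -> : Normc.normc (v l)^*%R = Normc.normc (v l).
    by case: (v l) => a b /=; rewrite sqrrN.
  by rewrite v1 mulr1.
- by rewrite cardsT card_ord.
- by move=> l; rewrite finset.in_setT.
Qed.

Lemma large_coef (K : finType) (c : K -> R[i]) M :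
  (#|supp c| <= M)%N -> 0 < l2norm c ->
  exists2 k, k \in supp c & l2norm c <= Num.sqrt M%:R * Normc.normc (c k).
Proof.
move=> cM c0.
have [k1 k1c] : exists k, k \in supp c.
  apply/existsP; apply: contraTT c0; rewrite negb_exists => /forallP h.
  rewrite -leNgt /l2norm big1 ?sqrtr0 // => k _.
  by have := h k; rewrite inE negbK => /eqP ->; rewrite Normc.normc0 expr0n.
case: (@arg_maxP _ _ _ k1 (mem (supp c)) (fun k => Normc.normc (c k)) k1c) => k kc kmax.
exists k => //.
rewrite -[Normc.normc _]ger0_norm ?normc_nonneg // -sqrtr_sqr -sqrtrM //.
rewrite /l2norm ler_sqrt; last by rewrite mulr_ge0 // sqr_ge0.
rewrite (bigID [pred j | j \in supp c]) /= [X in _ + X]big1 ?addr0; last first.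
  by move=> j; rewrite inE negbK => /eqP ->; rewrite Normc.normc0 expr0n.
apply: (@le_trans _ _ (\sum_(j in supp c) Normc.normc (c k) ^+ 2)).
  apply: ler_sum => j jc; rewrite ler_pXn2r ?nnegrE ?normc_nonneg //.
  exact: kmax.
by rewrite sumr_const -[X in X <= _]mulr_natl ler_wpM2r ?sqr_ge0 // ler_nat.
Qed.

End Norms.

Section FirstStep.
Context {R : realType} {d : nat} {Gamma : {fset d.-tuple int}}.
Variables (c : Gamma -> R[i]) (N : nat) (x : 'I_N -> d.-tuple R).
Local Notation freq := (fun k : Gamma => @phase R d (val k)).

Lemma phiE (k : Gamma) l : phi x k l = cexp (phase (val k) (x l)).
Proof. by []. Qed.

Lemma dotc_trig_poly (k : Gamma) : dotc (fun l => trig_poly c (x l)) (phi x k)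
  = N%:R * c k + \sum_(l < N) trig_sum freq k (off_coef c k) (x l).
Proof.
rewrite mulr_natl -[N in _ *+ N]card_ord -sumr_const -big_split /=.
apply: eq_bigr => l _; rewrite /trig_poly mulr_suml (bigD1 k) //=.
rewrite /trig_sum [in RHS](bigD1 k) //= /off_coef eqxx mul0r add0r; congr (_ + _).
  rewrite phiE -mulrA -[character_at _ _]/(cexp (phase (val k) (x l))).
  by rewrite cexp_mul_conj subrr /cexp cos0 sin0; exact: mulr1.
apply: eq_bigr => j /negbTE ->.
by rewrite phiE -mulrA -[character_at _ _]/(cexp (phase (val j) (x l))) cexp_mul_conj.
Qed.

(** In the unit [mu = N |c| / sqrt M], the selected correlation would be at most
    [1/4 + (1 - tau)/4] outside the support, but it is at least [3/4 - (1 -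
    tau)/4] at the largest coefficient. The coordinatewise bound [mu / 6] gives
    modulus at most [mu / 4] since [sqrt 2 / 6 < 1 / 4]. *)
Lemma first_step_correct (M : nat) (tau sigma : R) (eta : 'I_N -> R[i])
    (r : omp_run Gamma x (fun l => trig_poly c (x l) + eta l) 1) :
  (0 < M)%N -> (0 < N)%N -> (#|supp c| <= M)%N -> 0 < tau -> 0 < l2norm c ->
  sigma <= (1 - tau) / 4 * Num.sqrt (N%:R / M%:R) * l2norm c ->
  l2norm eta <= sigma ->
  (forall k, let z := \sum_(l < N) trig_sum freq k (off_coef c k) (x l) in
    `|complex.Re z| < N%:R * l2norm c / Num.sqrt M%:R / 6 /\
    `|complex.Im z| < N%:R * l2norm c / Num.sqrt M%:R / 6) ->
  sel r 1%N \in supp c.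
Proof.
move=> M0 N0 cM tau0 c0 sig_le eta_le dev.
set y := (fun l => trig_poly c (x l) + eta l) in r *.
set mu := N%:R * l2norm c / Num.sqrt M%:R in dev.
have sM0 : 0 < Num.sqrt M%:R :> R by rewrite sqrtr_gt0 ltr0n.
have N0R : 0 < N%:R :> R by rewrite ltr0n.
have mu0 : 0 < mu by rewrite divr_gt0 // mulr_gt0.
have noise k : Normc.normc (dotc eta (phi x k)) <= (1 - tau) / 4 * mu.
  have phi1 l : Normc.normc (phi x k l) = 1 by exact: normc_cexp.
  apply: (le_trans (normc_dotc_le eta N0 phi1)).
  apply: le_trans (ler_wpM2l (sqrtr_ge0 _) (le_trans eta_le sig_le)) _.
  rewrite le_eqVlt; apply/orP; left; apply/eqP.
  have sN2 : Num.sqrt N%:R * Num.sqrt N%:R = N%:R :> R by rewrite -expr2 sqr_sqrtr // ltW.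
  rewrite sqrtrM ?ltW // sqrtrV ?ler0n // /mu -[in RHS]sN2.
  by field; rewrite gt_eqF.
have z_le k : Normc.normc (\sum_(l < N) trig_sum freq k (off_coef c k) (x l)) <= mu / 4.
  have /= := dev k; move: (\sum_(l < N) _) => z [].
  rewrite !ltr_norml => /andP[r1 r2] /andP[i1 i2].
  have m4 : 0 <= mu / 4 by rewrite divr_ge0 // ltW.
  rewrite -(ler_pXn2r (n := 2)) ?nnegrE ?normc_nonneg // normc_sqr /sqmod.
  have hr : complex.Re z ^+ 2 <= (mu / 6) ^+ 2 by nra.
  have hi : complex.Im z ^+ 2 <= (mu / 6) ^+ 2 by nra.
  have := sqr_ge0 mu; nra.
have dotE k : dotc y (phi x k) = N%:R * c k +
    (\sum_(l < N) trig_sum freq k (off_coef c k) (x l) + dotc eta (phi x k)).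
  rewrite addrA -dotc_trig_poly /dotc -big_split /=.
  by apply: eq_bigr => l _; rewrite mulrDl.
have err k : Normc.normc (\sum_(l < N) trig_sum freq k (off_coef c k) (x l)
    + dotc eta (phi x k)) <= mu / 4 + (1 - tau) / 4 * mu.
  by apply: le_trans (le_normcD _ _) _; exact: lerD.
have [k0 k0c ck0] := large_coef cM c0.
apply/negPn/negP => sel_out.
have csel0 : c (sel r 1) = 0 by move: sel_out; rewrite inE negbK => /eqP.
have := omp_sel r (ltnSn 0) k0.
rewrite omp_res0 => sel_max.
have up : Normc.normc (dotc y (phi x (sel r 1))) <= mu / 4 + (1 - tau) / 4 * mu.
  by rewrite dotE csel0 mulr0 add0r.
have low : mu - (mu / 4 + (1 - tau) / 4 * mu) <= Normc.normc (dotc y (phi x k0)).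
  rewrite lerBlDr; apply: (@le_trans _ _ (Normc.normc (N%:R * c k0))).
    rewrite Normc.normcM.
    have -> : Normc.normc (N%:R : R[i]) = N%:R.
      by rewrite -(rmorph_nat (real_complex R)) /= expr0n /= addr0 sqrtr_sqr ger0_norm.
    by rewrite /mu -mulrA ler_wpM2l ?ler0n // ler_pdivrMr // mulrC.
  apply: le_trans (_ : Normc.normc (dotc y (phi x k0)) +
    Normc.normc (- (\sum_(l < N) trig_sum freq k0 (off_coef c k0) (x l)
    + dotc eta (phi x k0))) <= _).
    by apply: le_trans (le_normcD _ _); rewrite dotE addrK.
  by rewrite normcN lerD2l.
have : 0 < tau * mu by rewrite mulr_gt0.
have := le_trans low (le_trans sel_max up); lra.
Qed.

End FirstStep.

Section LeastSquares.
Context {R : realType}.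

(** The real part of [a * b^*], the real inner product of the plane. *)
Definition redot (a b : R[i]) : R :=
  complex.Re a * complex.Re b + complex.Im a * complex.Im b.

Lemma sqmodD (t : R) (a b : R[i]) :
  sqmod (a + t%:C * b) = sqmod a + 2 * t * redot a b + t ^+ 2 * sqmod b.
Proof. by case: a b => a1 a2 [b1 b2]; rewrite /sqmod /redot /=; ring. Qed.

Lemma sqmod_sumD (I : finType) (t : R) (a b : I -> R[i]) :
  \sum_i sqmod (a i + t%:C * b i)
    = \sum_i sqmod (a i) + 2 * t * (\sum_i redot (a i) (b i))
      + t ^+ 2 * \sum_i sqmod (b i).
Proof.
rewrite !mulr_sumr -!big_split /=; apply: eq_bigr => i _; exact: sqmodD.
Qed.

(** Minimality along the line through [a] in the direction [b] makes the real
    inner product of [a] and [b] nonnegative, so adding [a] to [b] does not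
    shorten it. *)
Lemma minimal_pythagoras (I : finType) (a b : I -> R[i]) :
  (forall t : R, l2norm a <= l2norm (fun i => a i + t%:C * b i)) ->
  \sum_i sqmod (b i) <= \sum_i sqmod (a i + b i).
Proof.
move=> a_min.
set A := \sum_i sqmod (a i); set B := \sum_i sqmod (b i).
set D := \sum_i redot (a i) (b i).
have A0 : 0 <= A by apply: sumr_ge0 => i _; rewrite addr_ge0 ?sqr_ge0.
have B0 : 0 <= B by apply: sumr_ge0 => i _; rewrite addr_ge0 ?sqr_ge0.
(* The squared distance along the line is a quadratic polynomial in [t], minimal
   at [0]. *)
have quad t : 0 <= 2 * t * D + t ^+ 2 * B.
  have := a_min t; rewrite -(ler_pXn2r (n := 2)) ?nnegrE ?l2norm_ge0 //.
  by rewrite !l2norm_sqr sqmod_sumD -/A -/B -/D; lra.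
have D0 : 0 <= D.
  rewrite leNgt; apply/negP => Dneg.
  have B1 : 0 < B + 1 by rewrite ltr_wpDl.
  (* The minimizer of the quadratic polynomial would be [- D / B]; adding [1]
     covers [B = 0]. *)
  have := quad (- D / (B + 1)).
  have -> : 2 * (- D / (B + 1)) * D + (- D / (B + 1)) ^+ 2 * B
      = - (D ^+ 2 * (B + 2) / (B + 1) ^+ 2) by field; rewrite gt_eqF.
  rewrite oppr_ge0 leNgt => /negP; apply.
  by rewrite divr_gt0 ?exprn_gt0 // mulr_gt0 ?ltr_wpDl // exprn_even_gt0 //= lt_eqF.
have := sqmod_sumD 1 a b.
under eq_bigr do rewrite mul1r.
by move=> ->; rewrite -/A -/B -/D; lra.
Qed.

Context {d : nat} {Gamma : {fset d.-tuple int}}.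
Variables (c : Gamma -> R[i]) (N : nat) (x : 'I_N -> d.-tuple R).

(** With [a] the residual of the least squares solution and [b] the image of the
    coefficient error, [a + b] is the opposite of the noise; minimality of [a]
    gives [|b| <= |noise|], and the lower bound on the columns turns this into a
    bound on the coefficients. *)
Lemma least_squares_error (M : nat) (sigma : R) (eta : 'I_N -> R[i])
    (r : omp_run Gamma x (fun l => trig_poly c (x l) + eta l) M) :
  (0 < M)%N -> (0 < N)%N -> 0 < sigma -> l2norm eta <= sigma ->
  (forall u : Gamma -> R[i], (forall k, k \notin supp c -> u k = 0) ->
    N%:R / 2 * (\sum_k sqmod (u k)) <= \sum_(l < N) sqmod (\sum_k phi x k l * u k)) ->
  act r M = supp c ->
  l2norm (fun k => c k - omp_output r k) <= Num.sqrt (2 / N%:R) * sigma.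
Proof.
case: M r => [//|M] r _ N0 s0 eta_le gram actT.
have N0R : 0 < N%:R :> R by rewrite ltr0n.
pose e k := c k - omp_output r k.
have e_out k : k \notin supp c -> e k = 0.
  move=> kc; rewrite /e /omp_output actT (negbTE kc) subr0.
  by move: kc; rewrite inE negbK => /eqP.
pose a l := F_mul x (supp c) (coef r M.+1) l - (trig_poly c (x l) + eta l).
pose b l := \sum_k phi x k l * e k.
have bE l : b l = F_mul x (supp c) e l.
  rewrite /b /F_mul (bigID [pred k | k \in supp c]) /= [X in _ + X]big1 ?addr0 //.
  by move=> k /e_out ->; rewrite mulr0.
have a_min (t : R) : l2norm a <= l2norm (fun l => a l + t%:C * b l).
  have := omp_coef r (ltnSn M) (fun k => coef r M.+1 k + t%:C * e k).
  rewrite actT; congr (_ <= _); rewrite /l2norm; congr (Num.sqrt _).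
  apply: eq_bigr => l _; congr (Normc.normc _ ^+ 2).
  rewrite /a bE addrAC; congr (_ - _).
  rewrite /F_mul mulr_sumr -big_split /=; apply: eq_bigr => k _.
  by rewrite mulrDr; congr (_ + _); rewrite mulrCA.
have abE l : a l + b l = - eta l.
  rewrite bE /a addrAC /F_mul -big_split /=.
  have -> : \sum_(k in supp c) (phi x k l * coef r M.+1 k + phi x k l * e k)
      = trig_poly c (x l).
    rewrite /trig_poly [RHS](bigID [pred k | k \in supp c]) /=.
    rewrite [X in _ = _ + X]big1 ?addr0; last first.
      by move=> k; rewrite inE negbK => /eqP ->; rewrite mul0r.
    apply: eq_bigr => k kc; rewrite -mulrDr /e /omp_output actT kc addrC subrK.
    exact: mulrC.
  by rewrite opprD addrA subrr add0r.
have Bs : \sum_l sqmod (b l) <= sigma ^+ 2.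
  apply: (le_trans (minimal_pythagoras a_min)).
  have -> : \sum_i sqmod (a i + b i) = l2norm eta ^+ 2.
    rewrite l2norm_sqr; apply: eq_bigr => l _; rewrite abE.
    by case: (eta l) => p q; rewrite /sqmod /= !sqrrN.
  by rewrite ler_pXn2r ?nnegrE ?l2norm_ge0 // ltW.
rewrite -/e -(ler_pXn2r (n := 2)) ?nnegrE ?l2norm_ge0 //; last first.
  by rewrite mulr_ge0 ?sqrtr_ge0 // ltW.
rewrite exprMn l2norm_sqr sqr_sqrtr ?divr_ge0 //.
have := le_trans (gram e e_out) Bs.
rewrite -ler_pdivlMl ?divr_gt0 // => /le_trans; apply.
by rewrite invf_div.
Qed.

End LeastSquares.

(** * Choice of the constants and the theorem *)

Section Numerics.
Context {R : realType}.
Variables (D M N : nat) (eps : R).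
Hypotheses (D2 : (1 < D)%N) (M0 : (0 < M)%N) (eps01 : 0 < eps < 1).
Let l : R := ln (D%:R / eps).
Hypothesis (lN : 1000 * M%:R * l <= N%:R).

Let eps0 : 0 < eps. Proof. by case/andP: eps01. Qed.
Let D2R : 2 <= D%:R :> R. Proof. by rewrite (ler_nat _ 2 D). Qed.
Let ratio_ge2 : 2 <= D%:R / eps.
Proof.
rewrite ler_pdivlMr //; apply: le_trans D2R.
by case/andP: eps01 => _ /ltW e1; lra.
Qed.
Let expl : expR l = D%:R / eps.
Proof. by rewrite lnK // posrE (lt_le_trans _ ratio_ge2). Qed.
Let l_half : 2^-1 <= l.
Proof.
rewrite -ler_expR expl; apply: le_trans ratio_ge2.
have h1 : (2^-1 : R) < 1 by lra.
apply: (le_trans (expR_le_inv h1)).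
by rewrite (_ : (1 - 2^-1)^-1 = 2 :> R) //; field.
Qed.
Let M0R : 0 < M%:R :> R. Proof. by rewrite ltr0n. Qed.

(** The exponent [2 ^ k] is the first power of two above [8 l]: large enough for
    [(7/8) ^ (2 ^ k) <= exp (- 2 ^ k / 8)] to beat [D / eps], and at most [16
    l], so that [2 ^ k * M] stays a small fraction of [N]. *)
Lemma exists_moment_order : exists k,
  (2 ^ k)%:R * M%:R <= N%:R / 4 :> R /\ D%:R * (7 / 8) ^+ (2 ^ k) < eps.
Proof.
have [k0 k0l] : exists k, 8 * l < (2 ^ k)%:R.
  exists (Num.bound (8 * l)); apply: (lt_trans (_ : _ < (Num.bound (8 * l))%:R)).
    by apply: archi_boundP; have := l_half; lra.
  by rewrite ltr_nat ltn_expl.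
have [k kl kmin] := ex_minnP (ex_intro (fun k => 8 * l < (2 ^ k)%:R) k0 k0l).
case: k kl kmin => [|k] kl kmin; first by move: kl l_half; rewrite expn0; lra.
have kle : (2 ^ k)%:R <= 8 * l.
  by rewrite leNgt; apply/negP => /kmin; rewrite ltnn.
exists k.+1; split.
  rewrite expnS natrM.
  have kM : (2 ^ k)%:R * M%:R <= 8 * l * M%:R by rewrite ler_pM2r.
  have lM : 0 <= l * M%:R by rewrite mulr_ge0 ?ltW //; have := l_half; lra.
  by have := lN; lra.
set p := (2 ^ k.+1)%N in kl *.
have h78 : (7 / 8) ^+ p <= expR (- (p%:R / 8)) :> R.
  have -> : - (p%:R / 8) = p%:R * (- 8^-1) :> R by ring.
  rewrite expRM_natl; apply: lerXn2r; rewrite ?nnegrE ?expR_ge0 //.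
  by apply: le_trans (expR_ge1Dx _); lra.
have hl : expR (- (p%:R / 8)) < eps / D%:R.
  have -> : eps / D%:R = expR (- l) by rewrite expRN expl invf_div.
  by rewrite ltr_expR; lra.
have D0 : 0 < D%:R :> R by have := D2R; lra.
by rewrite mulrC -ltr_pdivlMr //; exact: le_lt_trans h78 hl.
Qed.

(** Since [N / (288 M)] exceeds [3 l], the exponential on the right gains [(D /
    eps) ^ 3], which beats [4 D / eps] because [D >= 2]. *)
Lemma deviation_numerics :
  (D * 4)%:R * expR (N%:R / (288 * M%:R)) < eps * expR (N%:R / (144 * M%:R)).
Proof.
have -> : N%:R / (144 * M%:R) = N%:R / (288 * M%:R) + N%:R / (288 * M%:R) :> R.
  by field; rewrite gt_eqF.
rewrite expRD mulrA ltr_pM2r ?expR_gt0 //.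
have : expR (3 * l) < expR (N%:R / (288 * M%:R)).
  rewrite ltr_expR ltr_pdivlMr ?mulr_gt0 //.
  have lM : 0 < l * M%:R by rewrite mulr_gt0 //; have := l_half; lra.
  by have := lN; lra.
have -> : expR (3 * l) = (D%:R / eps) ^+ 3.
  by rewrite -expl -expRM_natl.
rewrite -(ltr_pM2l eps0 (_ ^+ 3)); apply: le_lt_trans.
have e1 : 1 <= eps^-1 by rewrite invf_ge1 //; case/andP: eps01 => _ /ltW.
have -> : eps * (D%:R / eps) ^+ 3 = D%:R ^+ 3 * eps^-1 ^+ 2.
  by field; rewrite gt_eqF.
have e2 : 1 <= eps^-1 ^+ 2 by rewrite exprn_ege1.
apply: (@le_trans _ _ (D%:R ^+ 3)); last by rewrite ler_peMr // exprn_ge0.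
rewrite natrM exprS ler_pM2l; last by have := D2R; lra.
by have := D2R; nra.
Qed.

End Numerics.

Lemma enum_set_ord (K : finType) (A : {set K}) : (0 < #|A|)%N ->
  exists n (g : 'I_n.+1 -> K), [/\ n.+1 = #|A|, injective g &
    forall (R : nmodType) (F : K -> R), \sum_(k in A) F k = \sum_i F (g i)].
Proof.
move=> A0; have e : #|A|.-1.+1 = #|A| by rewrite prednK.
exists #|A|.-1, (fun i => enum_val (cast_ord e i)); split=> //.
  by move=> i j /enum_val_inj /cast_ord_inj.
move=> R F; rewrite big_enum_val (reindex (cast_ord e)) //.
by exists (cast_ord (esym e)) => i _; rewrite ?cast_ordK ?cast_ordKV.
Qed.

Theorem theorem4p1 (R : realType) :
  exists C : R, 0 < C /\
  forall (d : nat) (Gamma : {fset d.-tuple int}) (M : nat)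
    (f : d.-tuple R -> R[i]) (c : Gamma -> R[i])
    (N : nat) (tau eps sigma : R),
  (0 < d)%N -> (0 < M)%N -> (0 < N)%N ->
  in_Pi M c f ->
  0 < tau < 1 -> 0 < eps < 1 ->
  C * M%:R * tau ^- 2 * ln (#|{: Gamma}|%:R / eps) <= N%:R ->
  0 < sigma ->
  sigma <= (1 - tau) / 4 * Num.sqrt (N%:R / M%:R) * l2norm c ->
  forall (disp : measure_display) (Omega : measurableType disp)
    (P : probability Omega R)
    (X : 'I_N -> {RV P >-> d.-tuple (measurableTypeR R)}),
  model1 X \/ model2 X Gamma ->
  forall eta : Omega -> 'I_N -> R[i],
  (forall w, l2norm (eta w) <= sigma) ->
  let x w := fun l : 'I_N => X l w : d.-tuple R in
  let y w := fun l : 'I_N => f (x w l) + eta w l in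
  prob_exceeds P (1 - eps)
    (fun w => forall r : omp_run Gamma (x w) (y w) 1, sel r 1%N \in supp c)
  /\
  prob_exceeds P (1 - eps)
    (fun w => forall r : omp_run Gamma (x w) (y w) M,
       act r M = supp c ->
       l2norm (fun k => c k - omp_output r k)
       <= Num.sqrt (2 / N%:R) * sigma).
Proof.
exists 1000; split; first by rewrite ltr0n.
move=> d Gamma M f c N tau eps sigma _ M0 N0.
move=> [[T [TM cT]] ->] tau01 eps01 HN s0 sig_le disp Omega P X model eta eta_le x y.
have [tau0 tau1] := andP tau01; have [eps0 eps1] := andP eps01.
have N0R : 0 < N%:R :> R by rewrite ltr0n.
have M0R : 0 < M%:R :> R by rewrite ltr0n.
have cM : (#|supp c| <= M)%N.
  apply: leq_trans TM; apply: subset_leq_card; apply/fintype.subsetP => k.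
  by rewrite inE; apply: contraNT => /cT ->.
have c0 : 0 < l2norm c.
  rewrite lt_neqAle l2norm_ge0 andbT; apply/eqP => c0.
  by move: (lt_le_trans s0 sig_le); rewrite -c0 mulr0 ltxx.
have [k0 k0c _] := large_coef cM c0.
have [indX canc'] := model_cancelling model.
pose freq (k : Gamma) := @phase R d (val k).
have mfreq k : measurable_fun [set: d.-tuple (measurableTypeR R)] (freq k).
  exact: measurable_phase.
have canc l (i j : Gamma) : i != j ->
    cancelling (distribution P (X l)) (fun x => freq i x - freq j x).
  move=> ij; have := canc' l i j ij; congr (cancelling _ _); apply/funext => v.
  rewrite /freq /phase -sumrB; apply: eq_bigr => t _.
  by rewrite tnth_mktuple intrB mulrBl.
(* A single frequency: it is the support, and its column has squared norm [N].
   *)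
have [D1|D2] := leqP #|{: Gamma}| 1.
  have allk (k : Gamma) : k = k0 by exact: (fintype_le1P D1).
  split; apply: prob_exceeds_sure => // w r; first by rewrite (allk (sel r 1)).
  apply: (least_squares_error M0 N0 s0 (eta_le w)) => u _.
  have sum1 (F : Gamma -> R[i]) : \sum_k F k = F k0.
    by rewrite (bigD1 k0) //= big1 ?addr0 // => k; rewrite (allk k) eqxx.
  have -> : \sum_k sqmod (u k) = sqmod (u k0).
    by rewrite (bigD1 k0) //= big1 ?addr0 // => k; rewrite (allk k) eqxx.
  rewrite (eq_bigr (fun=> sqmod (u k0))); last first.
    move=> l _; rewrite sum1 -!normc_sqr Normc.normcM.
    by rewrite [X in X * _](_ : _ = 1) ?mul1r //; exact: normc_cexp.
  rewrite sumr_const card_ord -[X in _ <= X]mulr_natl ler_wpM2r //; last lra.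
  by rewrite addr_ge0 ?sqr_ge0.
pose L := ln (#|{: Gamma}|%:R / eps).
have HN' : 1000 * M%:R * L <= N%:R.
  apply: le_trans HN.
  have L0 : 0 <= L.
    apply: ln_ge0; rewrite ler_pdivlMr // mul1r (le_trans (ltW eps1)) //.
    by rewrite (ler_nat _ 1) ltnW.
  rewrite ler_wpM2r // ler_peMr ?mulr_ge0 ?ler0n //.
  by rewrite invf_ge1 ?exprn_gt0 // exprn_ile1 // ltW.
split.
  pose W := Num.sqrt M%:R * l2norm c.
  have sM0 : 0 < Num.sqrt M%:R :> R by rewrite sqrtr_gt0.
  have sM2 : Num.sqrt M%:R ^+ 2 = M%:R :> R by rewrite sqr_sqrtr // ltW.
  have W0 : 0 < W by rewrite mulr_gt0.
  have cW : \sum_j Normc.normc (c j) <= W.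
    apply: (sum_le_sqrt (A := supp c)) => // j.
    by rewrite inE negbK => /eqP ->; rewrite Normc.normc0.
  have cS : \sum_j sqmod (c j) <= l2norm c ^+ 2 by rewrite l2norm_sqr.
  (* With deviations [t] this size, [2 N lambda^2 |c|^2] is [N / (288 M)] and
     [lambda t] is twice as large, the optimal ratio. *)
  pose lambda := (24 * W)^-1.
  have lambda0 : 0 < lambda by rewrite invr_gt0 mulr_gt0.
  have lW : lambda * W <= 2^-1.
    have -> : lambda * W = 24^-1 by rewrite /lambda; field; rewrite gt_eqF.
    lra.
  pose t := N%:R * l2norm c / Num.sqrt M%:R / 6.
  have small : (#|{: Gamma}| * 4)%:R * expR (N%:R * (2 * lambda ^+ 2 * l2norm c ^+ 2))
      < eps * expR (lambda * t).
    have := deviation_numerics D2 M0 eps01 HN'.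
    have -> : N%:R * (2 * lambda ^+ 2 * l2norm c ^+ 2) = N%:R / (288 * M%:R).
      by rewrite /lambda /W -[in RHS]sM2; field; rewrite !gt_eqF.
    have -> : lambda * t = N%:R / (144 * M%:R).
      by rewrite /lambda /t /W -[in RHS]sM2; field; rewrite !gt_eqF.
    by [].
  apply: prob_exceedsW (off_deviation mfreq indX canc cW cS lambda0 lW small).
  by move=> w dev r; exact: (first_step_correct r M0 N0 cM tau0 c0 sig_le (eta_le w) dev).
have A0 : (0 < #|supp c|)%N by apply/card_gt0P; exists k0.
have [n [g [gn ginj gsum]]] := enum_set_ord A0.
have [k [kN keps]] := exists_moment_order D2 M0 eps01 HN'.
have kN' : (2 ^ k)%:R * n.+1%:R <= N%:R / 4 :> R.
  by apply: le_trans kN; rewrite ler_wpM2l // ler_nat gn.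
have keps' : n.+1%:R * (7 / 8) ^+ (2 ^ k) < eps :> R.
  apply: le_lt_trans keps; rewrite ler_wpM2r ?exprn_ge0 //.
  by rewrite ler_nat gn; exact: max_card.
have mg i : measurable_fun [set: d.-tuple (measurableTypeR R)] (freq (g i)) by exact: mfreq.
have cg l i j : i != j ->
    cancelling (distribution P (X l)) (fun x => freq (g i) x - freq (g j) x).
  by move=> ij; apply: canc; rewrite (inj_eq ginj).
have gram_event := gram_lower_bound mg N0 indX cg kN' keps'.
apply: (prob_exceedsW _ gram_event).
move=> w gram r; apply: (least_squares_error M0 N0 s0 (eta_le w)) => u u_out.
  have sum_supp (V : nmodType) (F : Gamma -> V) :
      (forall k, k \notin supp c -> F k = 0) -> \sum_k F k = \sum_i F (g i).
    move=> F0; rewrite -gsum (bigID [pred k | k \in supp c]) /=.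
    by rewrite [X in _ + X]big1 ?addr0 // => j /F0.
  have := gram (\row_i (u (g i))^*).
  rewrite sqnorm_sqmod.
  have -> : \sum_i sqmod ((\row_i (u (g i))^*) 0 i) = \sum_k sqmod (u k).
    rewrite sum_supp; last by move=> j /u_out ->; rewrite /sqmod /= expr0n /= addr0.
    apply: eq_bigr => i _; rewrite mxE -!normc_sqr.
    by case: (u (g i)) => p q /=; rewrite sqrrN.
  have -> : \sum_(l < N) qform (outer (exp_row (fun i => freq (g i)) (X l w)))
      (\row_i (u (g i))^*)
     = (\sum_(l < N) sqmod (\sum_k phi (x w) k l * u k))%:C%C.
    rewrite rmorph_sum; apply: eq_bigr => l _; rewrite qform_outer; congr (sqmod _)%:C%C.
    rewrite sum_supp; last by move=> j /u_out ->; rewrite mulr0.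
    by apply: eq_bigr => i _; rewrite !mxE conjCK.
  by rewrite -rmorphM lecR.
Qed.
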